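(* Let $1\le p<\infty$, $m\ge1$, let $X,Y$ be Banach spaces over $\mathbb{K}$ and let $P\in\mathcal{P}(^mX;Y)$. Then $P$ is factorable strongly $p$-summing if and only if there exist a regular Borel probability measure $\mu$ on $B_{\mathcal{P}(^mX)}$ (endowed with the weak-star topology), a closed subspace $G_p$ of $L_p(\mu)$ and a continuous linear operator $v_0:G_p\to Y$ such that $j_p\circ\delta(X)\subset G_p$ and $v_0\circ j_p\circ\delta=P$, where $j_p:C(B_{\mathcal{P}(^mX)})\to L_p(B_{\mathcal{P}(^mX)},\mu)$ is the canonical inclusion and $\delta:X\to C(B_{\mathcal{P}(^mX)})$ is the $m$-homogeneous polynomial $\delta(x)=\delta_x$, $\delta_x(q)=q(x)$.
   Context: $\mathbb{K}=\mathbb{R}$ or $\mathbb{C}$. $\mathcal{P}(^mX;Y)$ is the space of continuous $m$-homogeneous polynomials from $X$ to $Y$, and $\mathcal{P}(^mX)=\mathcal{P}(^mX;\mathbb{K})$ with the sup norm on the unit ball of $X$; $B_{\mathcal{P}(^mX)}$ is its closed unit ball. $\mathcal{P}(^mX)$ is the dual of the completed $m$-fold symmetric tensor product $\hat\otimes^{m,s}_{\pi_s}X$ (the completion of the span $\otimes^{m,s}X$ of the tensors $x\otimes\cdots\otimes x$ under $\pi_s(z)=\inf\{\sum_{j=1}^k|\lambda_j|\|x_j\|^m: z=\sum_{j=1}^k\lambda_jx_j\otimes\cdots\otimes x_j\}$), via $q(x\otimes\cdots\otimes x)=q(x)$; the weak-star topology refers to this duality, and makes $B_{\mathcal{P}(^mX)}$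 compact. The ''canonical inclusion'' $j_p$ sends a continuous function to its $\mu$-a.e. equivalence class. A polynomial $P\in\mathcal{P}(^mX;Y)$ is factorable strongly $p$-summing if there is $C\ge0$ such that for all positive integers $m_1,m_2$, all $x_j^i\in X$ and all scalars $\lambda_j^i$ ($1\le j\le m_1$, $1\le i\le m_2$), $$\left(\sum_{j=1}^{m_1}\Big\|\sum_{i=1}^{m_2}\lambda_j^iP(x_j^i)\Big\|^p\right)^{1/p}\le C\sup_{q\in\mathcal{P}(^mX),\,\|q\|\le1}\left(\sum_{j=1}^{m_1}\Big|\sum_{i=1}^{m_2}\lambda_j^iq(x_j^i)\Big|^p\right)^{1/p}.$$ *)

(* Defs.v *)
From HB Require Import structures.
From mathcomp Require Import all_boot all_order all_algebra.
From mathcomp Require Import generic_quotient.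
From mathcomp Require Import complex.
From mathcomp Require Import all_classical all_reals all_analysis.
From mathcomp Require Import measurable_realfun.

Set Implicit Arguments.
Unset Strict Implicit.
Unset Printing Implicit Defensive.

Import Order.TTheory GRing.Theory Num.Theory.
Import numFieldNormedType.Exports.

Local Open Scope classical_set_scope.
Local Open Scope ring_scope.

Variant scalar_kind := RealScalars | ComplexScalars.

Definition scalar_field (R : realType) (k : scalar_kind) : numFieldType :=
  match k with
  | RealScalars => R
  | ComplexScalars => complex.complex R
  end.

Definition re (R : realType) (k : scalar_kind) : scalar_field R k -> R :=
  match k with
  | RealScalars => fun x => x
  | ComplexScalars => @complex.Re R
  end.

Definition im (R : realType) (k : scalar_kind) : scalar_field R k -> R :=
  match k with
  | RealScalars => fun=> 0
  | ComplexScalars => @complex.Im R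
  end.

Definition of_real (R : realType) (k : scalar_kind) : R -> scalar_field R k :=
  match k with
  | RealScalars => fun x => x
  | ComplexScalars => fun x => complex.Complex x 0
  end.

(* In a normedModType over R[i] the norm is a nonnegative element of R[i];
   [rnorm] is the corresponding real number. *)
Definition rnorm (R : realType) (k : scalar_kind)
  (V : normedZmodType (scalar_field R k)) (x : V) : R := re `|x|.

Section scalar_theory.
Context (R : realType) (k : scalar_kind).
Local Notation K := (scalar_field R k).
Implicit Types (x y : K) (V : normedModType K).

Lemma reD x y : re (x + y) = re x + re y.
Proof. by case: k x y => //= -[? ?] [? ?]. Qed.

Lemma imD x y : im (x + y) = im x + im y.
Proof. by case: k x y => //= [? ?|[? ?] [? ?]//]; rewrite addr0. Qed.

Lemma reM x y : re (x * y) = re x * re y - im x * im y.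
Proof. by case: k x y => //= [? ?|[? ?] [? ?]//]; rewrite mul0r subr0. Qed.

Lemma imM x y : im (x * y) = re x * im y + im x * re y.
Proof. by case: k x y => //= [? ?|[? ?] [? ?]//]; rewrite mulr0 mul0r addr0. Qed.

Lemma re0 : re (0 : K) = 0. Proof. by case: k. Qed.
Lemma im0 : im (0 : K) = 0. Proof. by case: k. Qed.

Lemma of_realK (r : R) : re (of_real k r) = r.
Proof. by case: k. Qed.

Lemma le_re x y : x <= y -> re x <= re y.
Proof. by case: k x y => //= x y; rewrite complex.lecE => /andP[]. Qed.

Lemma of_real_re x : 0 <= x -> of_real k (re x) = x.
Proof.
by case: k x => //= -[a b]; rewrite complex.lecE /= => /andP[/eqP -> _].
Qed.

Lemma im_ge0 x : 0 <= x -> im x = 0.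
Proof. by case: k x => //= -[a b]; rewrite complex.lecE /= => /andP[/eqP]. Qed.

Lemma of_realD (r s : R) : of_real k (r + s) = of_real k r + of_real k s.
Proof. by case: k => //=; apply/eqP; rewrite complex.eq_complex /= addr0 !eqxx. Qed.

Lemma of_realM (r s : R) : of_real k (r * s) = of_real k r * of_real k s.
Proof.
case: k => //=; apply/eqP.
by rewrite complex.eq_complex /= !mul0r mulr0 subr0 addr0 !eqxx.
Qed.

Lemma le_of_real (r s : R) : r <= s -> of_real k r <= of_real k s.
Proof. by case: k => //= ?; rewrite complex.lecE /= eqxx. Qed.

Lemma rnorm_ge0 (V : normedZmodType K) (v : V) : 0 <= rnorm v.
Proof. by rewrite -re0; apply: le_re. Qed.

Lemma of_real_rnorm (V : normedZmodType K) (v : V) : of_real k (rnorm v) = `|v|.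
Proof. exact: of_real_re. Qed.

Lemma rnormD (V : normedZmodType K) (v w : V) : rnorm (v + w) <= rnorm v + rnorm w.
Proof. by rewrite -reD; apply/le_re/ler_normD. Qed.

Lemma rnormM x y : rnorm (x * y) = rnorm x * rnorm y.
Proof. by rewrite /rnorm normrM reM im_ge0// mul0r subr0. Qed.

Lemma rnorm0_eq0 x : rnorm x = 0 -> x = 0.
Proof.
move=> x0; apply: normr0_eq0; rewrite -of_real_rnorm x0.
by case: k.
Qed.

Lemma rnorm0 : rnorm (0 : K) = 0.
Proof. by rewrite /rnorm normr0 re0. Qed.

Lemma rnormN x : rnorm (- x) = rnorm x.
Proof. by rewrite /rnorm normrN. Qed.

Lemma rnormE x : rnorm x = Num.sqrt (re x ^+ 2 + im x ^+ 2).
Proof.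
case: k x => /= x; last first.
  by have := congr1 (@complex.Re R) (complex.normc_def x); rewrite /rnorm /=.
by rewrite expr0n addr0 sqrtr_sqr.
Qed.

Lemma abs_re x : `|re x| <= rnorm x.
Proof. by rewrite rnormE -sqrtr_sqr ler_wsqrtr// lerDl sqr_ge0. Qed.

Lemma abs_im x : `|im x| <= rnorm x.
Proof. by rewrite rnormE -sqrtr_sqr ler_wsqrtr// lerDr sqr_ge0. Qed.

Lemma of_real_gt0 (e : R) : 0 < e -> 0 < of_real k e.
Proof. by case: k => //= ?; rewrite complex.ltcE /= eqxx. Qed.

Lemma lt_re x y : x < y -> re x < re y.
Proof. by case: k x y => //= x y; rewrite complex.ltcE => /andP[]. Qed.

Lemma reN x : re (- x) = - re x.
Proof. by case: k x => //= -[]. Qed.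

Lemma imN x : im (- x) = - im x.
Proof. by case: k x => //= [x|[] //]; rewrite oppr0. Qed.

Lemma continuous_re : continuous (@re R k).
Proof.
move=> x; have FF := nbhs_filter x; apply/cvgrPdist_lt => e e0.
apply/nbhs_normP.
exists (of_real k e); first exact: of_real_gt0.
move=> y /lt_re; rewrite of_realK => xy; rewrite /= -reN -reD.
exact: le_lt_trans (abs_re _) xy.
Qed.

Lemma continuous_im : continuous (@im R k).
Proof.
move=> x; have FF := nbhs_filter x; apply/cvgrPdist_lt => e e0.
apply/nbhs_normP.
exists (of_real k e); first exact: of_real_gt0.
move=> y /lt_re; rewrite of_realK => xy; rewrite /= -imN -imD.
exact: le_lt_trans (abs_im _) xy.
Qed.

Lemma continuous_rnorm : continuous (fun x : K => rnorm x).
Proof.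
move=> x; apply: (continuous_comp (f := fun x : K => `|x|)).
  exact: norm_continuous.
exact: continuous_re.
Qed.

End scalar_theory.

Section Lp.
Context d (T : measurableType d) (R : realType) (k : scalar_kind).
Local Notation K := (scalar_field R k).

(* Measurability of K-valued functions is componentwise. *)
Definition scalar_measurable (f : T -> K) :=
  measurable_fun [set: T] (fun x => re (f x)) /\
  measurable_fun [set: T] (fun x => im (f x)).

Lemma measurable_rnorm (f : T -> K) : scalar_measurable f ->
  measurable_fun [set: T] (fun x => rnorm (f x)).
Proof.
move=> [mr mi]; under eq_fun do rewrite rnormE.
apply: (measurableT_comp (f := @Num.sqrt R)).
  by apply: continuous_measurable_fun; exact: sqrt_continuous.
by apply: measurable_funD; apply: measurable_funX.
Qed.

Variables (mu : {measure set T -> \bar R}) (p : R) (p1 : 1 <= p).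

Definition Lp_seminorm (f : T -> K) : \bar R :=
  ('N[mu]_p%:E [EFin \o (fun x => rnorm (f x))])%E.

Definition Lp_fun : set (T -> K^o) :=
  [set f | scalar_measurable f /\ (Lp_seminorm f < +oo)%E].

Lemma Lp_seminorm_ge0 f : (0 <= Lp_seminorm f)%E.
Proof. exact: Lnorm_ge0. Qed.

Lemma le_Lnorm (f g : T -> R) : measurable_fun setT f -> measurable_fun setT g ->
  (forall x, 0 <= f x <= g x) ->
  ('N[mu]_p%:E [EFin \o f] <= 'N[mu]_p%:E [EFin \o g])%E.
Proof.
move=> mf mg fg; have p0 : 0 < p by exact: lt_le_trans p1.
rewrite unlock; apply: gt0_ler_poweR.
- by rewrite invr_ge0 ltW.
- by rewrite in_itv/= leey andbT; apply: integral_ge0 => x _; rewrite lee_fin powR_ge0.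
- by rewrite in_itv/= leey andbT; apply: integral_ge0 => x _; rewrite lee_fin powR_ge0.
apply: ge0_le_integral => //.
- by move=> x _; rewrite lee_fin powR_ge0.
- apply/measurable_EFinP; apply: (measurableT_comp (measurable_powR p)).
  exact: measurableT_comp.
- apply/measurable_EFinP; apply: (measurableT_comp (measurable_powR p)).
  exact: measurableT_comp.
move=> x _ /=; have /andP[f0 fgx] := fg x.
by rewrite lee_fin ge0_ler_powR ?nnegrE ?normr_ge0 ?(ltW p0)// !ger0_norm// (le_trans f0).
Qed.

Lemma Lp_seminormD f g : scalar_measurable f -> scalar_measurable g ->
  (Lp_seminorm (fun x => f x + g x)%R <= Lp_seminorm f + Lp_seminorm g)%E.
Proof.
move=> mf mg; have mfg : scalar_measurable (fun x => f x + g x).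
  case: mf mg => [? ?] [? ?]; split => /=.
    by under eq_fun do rewrite reD; exact: measurable_funD.
  by under eq_fun do rewrite imD; exact: measurable_funD.
have rf := measurable_rnorm mf; have rg := measurable_rnorm mg.
apply: le_trans (minkowski_EFin _ rf rg p1).
apply: le_Lnorm; first exact: measurable_rnorm.
  exact: measurable_funD.
by move=> x /=; rewrite rnorm_ge0 rnormD.
Qed.

Lemma Lp_seminormZ (a : K) f : scalar_measurable f ->
  Lp_seminorm (fun x => a * f x) = ((rnorm a)%:E * Lp_seminorm f)%E.
Proof.
move=> /measurable_rnorm mf; have p0 : 0 < p by exact: lt_le_trans p1.
rewrite /Lp_seminorm unlock /=.
under eq_integral => x _.
  rewrite rnormM normrM powRM// EFinM ger0_norm ?rnorm_ge0//.
  over.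
rewrite ge0_integralZl//=.
- rewrite poweRM ?lee_fin ?powR_ge0 ?integral_ge0//.
    by rewrite poweR_EFin -powRrM mulfV ?gt_eqF// powRr1// rnorm_ge0.
- apply/measurable_EFinP; apply: (measurableT_comp (measurable_powR p)).
  exact: measurableT_comp.
- by rewrite lee_fin powR_ge0.
Qed.

Lemma Lp_seminorm0 : Lp_seminorm (fun=> 0) = 0%E.
Proof.
rewrite /Lp_seminorm (_ : _ \o _ = cst 0%E).
  by rewrite Lnorm0// eqe gt_eqF// (lt_le_trans _ p1).
by apply/funext => x /=; rewrite rnorm0.
Qed.

Lemma Lp_fun_submod : submod_closed (mem Lp_fun).
Proof.
split=> [|a f g].
  rewrite inE; split; last by rewrite Lp_seminorm0.
  split.
    by rewrite (_ : (fun=> _) = cst (re (0 : K))).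
  by rewrite (_ : (fun=> _) = cst (im (0 : K))).
rewrite !inE => -[mf lf] [mg lg].
have maf : scalar_measurable (fun x => a * f x).
  case: mf => [mr mi]; split.
    under eq_fun do rewrite reM.
    by apply: measurable_funB; apply: measurable_funM.
  under eq_fun do rewrite imM.
  by apply: measurable_funD; apply: measurable_funM.
have mafg : scalar_measurable (a *: f + g).
  case: maf mg => [? ?] [? ?]; split.
    under eq_fun do rewrite [X in re X]/(a * _ + _) reD.
    exact: measurable_funD.
  under eq_fun do rewrite [X in im X]/(a * _ + _) imD.
  exact: measurable_funD.
split => //; apply: le_lt_trans (Lp_seminormD maf mg) _.
rewrite Lp_seminormZ//; apply: lte_add_pinfty => //.
by rewrite lte_mul_pinfty// lee_fin rnorm_ge0.
Qed.

End Lp.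

Section Lp_space.
Context d (T : measurableType d) (R : realType) (k : scalar_kind).
Local Notation K := (scalar_field R k).
Variables (mu : {measure set T -> \bar R}) (p : R) (p1 : 1 <= p).

Definition Lp_pred : {pred T -> K^o} := mem (Lp_fun mu p).

(* p-integrable functions, before identifying those equal a.e.; the proof of
   1 <= p is a parameter so that the instances below can use it. *)
Record Lp_pre (q1 : 1 <= p) := LpPre {
  Lp_pre_val :> T -> K^o;
  Lp_pre_valP : Lp_pre_val \in Lp_pred }.

HB.instance Definition _ := [isSub of Lp_pre p1 for @Lp_pre_val p1].
HB.instance Definition _ := [Choice of Lp_pre p1 by <:].

#[local] HB.instance Definition _ :=
  GRing.isSubmodClosed.Build K (T -> K^o) Lp_pred (Lp_fun_submod k mu p1).
HB.instance Definition _ := [SubChoice_isSubLmodule of Lp_pre p1 by <:].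

Lemma Lp_preP (f : Lp_pre p1) : Lp_fun mu p f.
Proof. by have := Lp_pre_valP f; rewrite inE. Qed.

Definition ae_equal (f g : Lp_pre p1) : bool := `[< {ae mu, forall x, f x = g x} >].

Let ae_equal_refl : reflexive ae_equal.
Proof. by move=> f; apply/asboolP; exact: aeW. Qed.

Let ae_equal_sym : symmetric ae_equal.
Proof.
move=> f g; apply/idP/idP => /asboolP fg; apply/asboolP;
  by apply: filterS fg => x ->.
Qed.

Let ae_equal_trans : transitive ae_equal.
Proof.
move=> g f h /asboolP fg /asboolP gh; apply/asboolP.
by apply: filterS2 fg gh => x -> ->.
Qed.

Canonical ae_equal_equiv :=
  EquivRel ae_equal ae_equal_refl ae_equal_sym ae_equal_trans.

Local Open Scope quotient_scope.

Definition Lp : Type := {eq_quot ae_equal}.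
HB.instance Definition _ := Choice.on Lp.
HB.instance Definition _ := EqQuotient.on Lp.

Lemma Lp_eqP (f g : Lp_pre p1) :
  (\pi_Lp f = \pi_Lp g) <-> {ae mu, forall x, f x = g x}.
Proof.
split=> [/eqP|fg]; first by rewrite eqmodE => /asboolP.
by apply/eqP; rewrite eqmodE; apply/asboolP.
Qed.

Lemma Lp_repr (f : Lp_pre p1) : {ae mu, forall x, repr (\pi_Lp f) x = f x}.
Proof. by apply/Lp_eqP; rewrite reprK. Qed.

Definition Lp_add (u v : Lp) : Lp := \pi_Lp (repr u + repr v).
Definition Lp_opp (u : Lp) : Lp := \pi_Lp (- repr u).
Definition Lp_scale (a : K) (u : Lp) : Lp := \pi_Lp (a *: repr u).

Lemma Lp_addE f g : Lp_add (\pi_Lp f) (\pi_Lp g) = \pi_Lp (f + g).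
Proof.
apply/Lp_eqP; have := Lp_repr g; apply: filterS2 (Lp_repr f) => x fE gE.
by rewrite /= /GRing.add /= fE gE.
Qed.

Lemma Lp_oppE f : Lp_opp (\pi_Lp f) = \pi_Lp (- f).
Proof.
by apply/Lp_eqP; apply: filterS (Lp_repr f) => x /= fE; rewrite -[LHS]/(- _) fE.
Qed.

Lemma Lp_scaleE a f : Lp_scale a (\pi_Lp f) = \pi_Lp (a *: f).
Proof.
by apply/Lp_eqP; apply: filterS (Lp_repr f) => x /= fE; rewrite -[LHS]/(a *: _) fE.
Qed.

Let addA : associative Lp_add.
Proof.
elim/quotW=> f; elim/quotW=> g; elim/quotW=> h.
by rewrite (Lp_addE g h) (Lp_addE f g) !Lp_addE addrA.
Qed.

Let addC : commutative Lp_add.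
Proof. by elim/quotW=> f; elim/quotW=> g; rewrite !Lp_addE addrC. Qed.

Let add0 : left_id (\pi_Lp 0) Lp_add.
Proof. by elim/quotW=> f; rewrite Lp_addE add0r. Qed.

Let addN : left_inverse (\pi_Lp 0) Lp_opp Lp_add.
Proof. by elim/quotW=> f; rewrite (Lp_oppE f) Lp_addE addNr. Qed.

HB.instance Definition _ := GRing.isZmodule.Build Lp addA addC add0 addN.

Let LpD f g : \pi_Lp f + \pi_Lp g = \pi_Lp (f + g) :> Lp.
Proof. exact: Lp_addE. Qed.

Let scaleA a b u : Lp_scale a (Lp_scale b u) = Lp_scale (a * b) u.
Proof. by elim/quotW: u => f; rewrite (Lp_scaleE b f) !Lp_scaleE scalerA. Qed.

Let scale1 : left_id 1 Lp_scale.
Proof. by elim/quotW=> f; rewrite Lp_scaleE scale1r. Qed.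

Let scaleDr : right_distributive Lp_scale +%R.
Proof.
move=> a; elim/quotW=> f; elim/quotW=> g.
by rewrite LpD (Lp_scaleE a f) (Lp_scaleE a g) (Lp_scaleE a (f + g)) LpD scalerDr.
Qed.

Let scaleDl u : {morph Lp_scale^~ u : a b / a + b}.
Proof. by move=> a b; elim/quotW: u => f; rewrite (Lp_scaleE a f) (Lp_scaleE b f) (Lp_scaleE (a + b) f) LpD scalerDl. Qed.

HB.instance Definition _ :=
  GRing.Zmodule_isLmodule.Build K Lp scaleA scale1 scaleDr scaleDl.

(* The library's normed modules over K carry a K-valued norm. *)
Definition Lp_norm (u : Lp) : K := of_real k (fine (Lp_seminorm mu p (repr u))).

Let measurable_integrand (f : Lp_pre p1) :
  measurable_fun setT (fun x => (`|(EFin \o (fun x => rnorm (f x))) x| `^ p)%E).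
Proof.
have [/measurable_rnorm mf _] := Lp_preP f.
apply/measurable_EFinP; apply: (measurableT_comp (measurable_powR p)).
exact: measurableT_comp.
Qed.

Lemma Lp_normE f : Lp_norm (\pi_Lp f) = of_real k (fine (Lp_seminorm mu p f)).
Proof.
congr (of_real _ (fine _)); rewrite /Lp_seminorm unlock; congr (_ `^ _)%E.
apply: ae_eq_integral => //; [exact: measurable_integrand..|].
by apply: filterS (Lp_repr f) => x fE _; rewrite /= fE.
Qed.

Let fineKf (f : Lp_pre p1) :
  (fine (Lp_seminorm mu p f))%:E = Lp_seminorm mu p f.
Proof.
rewrite fineK// ge0_fin_numE ?Lp_seminorm_ge0//.
by have [] := Lp_preP f.
Qed.

Let normD u v : Lp_norm (u + v) <= Lp_norm u + Lp_norm v.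
Proof.
elim/quotW: u => f; elim/quotW: v => g; rewrite LpD !Lp_normE -of_realD.
apply: le_of_real; rewrite -lee_fin EFinD !fineKf.
by have [[mf _] [mg _]] := (Lp_preP f, Lp_preP g); exact: Lp_seminormD.
Qed.

Let normZ (a : K) u : Lp_norm (a *: u) = `|a| * Lp_norm u.
Proof.
elim/quotW: u => f; rewrite -[_ *: _]/(Lp_scale _ _) (Lp_scaleE a f) !Lp_normE.
have [mf _] := Lp_preP f.
have -> : Lp_seminorm mu p (a *: f) = ((rnorm a)%:E * Lp_seminorm mu p f)%E.
  by rewrite -Lp_seminormZ.
by rewrite -fineKf -EFinM /= of_realM of_real_rnorm.
Qed.

Let norm0_eq0 u : Lp_norm u = 0 -> u = 0.
Proof.
elim/quotW: u => f; rewrite Lp_normE => /(congr1 (@re R k)).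
rewrite of_realK re0 => f0; apply/Lp_eqP.
have [mf _] := Lp_preP f.
have : Lp_seminorm mu p f = 0%E by rewrite -fineKf f0.
move=> /Lnorm_eq0_eq0; rewrite lte_fin (lt_le_trans _ p1)// => h.
have /h := (measurable_EFinP _ _).2 (measurable_rnorm mf).
by move=> /(_ isT); apply: filterS => x /(_ I) [/rnorm0_eq0].
Qed.

HB.instance Definition _ :=
  Lmodule_isNormed.Build K Lp normD normZ norm0_eq0.

End Lp_space.
Arguments Lp {d T R} k mu {p} p1.

Section polynomials.
Context (R : realType) (k : scalar_kind).
Local Notation K := (scalar_field R k).

Definition multilinear m (X Y : lmodType K) (A : ('I_m -> X) -> Y) :=
  forall (i : 'I_m) (x : 'I_m -> X), linear (fun u => A (dfwith x i u)).

Definition cont_hom_poly m (X Y : normedModType K) (P : X -> Y) :=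
  continuous P /\
  exists A : ('I_m -> X) -> Y, multilinear A /\ forall x, P x = A (fun=> x).

Definition poly_norm (X : normedModType K) (q : X -> K^o) : \bar R :=
  ereal_sup [set (rnorm (q x))%:E | x in [set x | rnorm x <= 1]].

Definition poly_ball m (X : normedModType K) : set (X -> K^o) :=
  [set q | cont_hom_poly m q /\ (poly_norm q <= 1)%E].
Arguments poly_ball : clear implicits.

Lemma poly_ball0 m (X : normedModType K) : poly_ball m X ((fun=> 0) : X -> K^o).
Proof.
split; first split.
- by move=> x; exact: cvg_cst.
- exists (fun=> 0); split=> // i x a u v.
  by rewrite scaler0 addr0.
by apply: ge_ereal_sup => _ [x _ <-]; rewrite rnorm0 lee_fin.
Qed.

(* The supremum is taken in \bar R; it is finite because every q in the unit
   ball satisfies rnorm (q x) <= rnorm x ^+ m. *)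
Definition factorable_strongly_summing (p : R) m (X Y : normedModType K)
    (P : X -> Y) :=
  exists2 C : R, 0 <= C &
    forall (m1 m2 : nat) (x : 'I_m1 -> 'I_m2 -> X) (l : 'I_m1 -> 'I_m2 -> K),
      (0 < m1)%N -> (0 < m2)%N ->
      (((\sum_(j < m1) rnorm (\sum_(i < m2) l j i *: P (x j i)) `^ p)
          `^ p^-1)%:E
       <= C%:E * ereal_sup
            [set ((\sum_(j < m1) rnorm (\sum_(i < m2) l j i * q (x j i)) `^ p)
                    `^ p^-1)%:E | q in poly_ball m X])%E.

End polynomials.
Arguments poly_ball {R k} m X _.

Section weak_star.
Context (R : realType) (k : scalar_kind).
Local Notation K := (scalar_field R k).
Variables (m : nat) (X : normedModType K).

(* The list [:: (l_1, x_1); ...; (l_n, x_n)] stands for the symmetric tensor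
   \sum_j l_j x_j (x) ... (x) x_j.  A tensor is identified with the linear
   functional it induces on the space of m-linear forms, so that two lists
   represent the same tensor when every m-linear form takes the same value. *)
Definition tensor_rep := seq (K * X).

Definition same_tensor (s t : tensor_rep) :=
  forall A : ('I_m -> X) -> K^o, multilinear A ->
    \sum_(a <- s) a.1 * A (fun=> a.2) = \sum_(a <- t) a.1 * A (fun=> a.2).

Definition tensor_sub (s t : tensor_rep) : tensor_rep :=
  s ++ [seq (- a.1, a.2) | a <- t].

Definition proj_norm (s : tensor_rep) : R :=
  inf [set \sum_(a <- t) rnorm a.1 * rnorm a.2 ^+ m | t in same_tensor s].

(* The completion: Cauchy sequences of tensors.  Sequences at distance tending
   to 0 are not identified, which is immaterial since they induce the same
   functional on P(^m X). *)
Record completed_tensor := CompletedTensor {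
  approx :> nat -> tensor_rep;
  approx_cauchy : forall e : R, 0 < e -> exists N : nat, forall i j : nat,
    (N <= i)%N -> (N <= j)%N -> proj_norm (tensor_sub (approx i) (approx j)) < e
}.

HB.instance Definition _ := gen_eqMixin completed_tensor.
HB.instance Definition _ := gen_choiceMixin completed_tensor.

Definition pairing (q : X -> K) (z : completed_tensor) : K :=
  lim ((\sum_(a <- z n) a.1 * q a.2) @[n --> \oo]).

Definition unit_ball : Type := poly_ball m X.

HB.instance Definition _ := Choice.on unit_ball.
HB.instance Definition _ :=
  isPointed.Build unit_ball (SigSub (mem_set (poly_ball0 m X))).

Definition weak_star_ball : Type :=
  initial_topology (fun q : unit_ball =>
    pairing (val q) : {ptws completed_tensor -> K}).

HB.instance Definition _ := PointedTopological.on weak_star_ball.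

Lemma proj_norm_eq0 s : same_tensor s [::] -> proj_norm s <= 0.
Proof.
move=> s0; apply: ge_inf.
  exists 0 => _ [t _ <-]; apply: sumr_ge0 => a _.
  by rewrite mulr_ge0 ?exprn_ge0 ?rnorm_ge0.
by exists [::] => //; rewrite big_nil.
Qed.

Lemma elementary_cauchy (x : X) (e : R) : 0 < e -> exists N : nat,
  forall i j : nat, (N <= i)%N -> (N <= j)%N ->
    proj_norm (tensor_sub [:: (1, x)] [:: (1, x)]) < e.
Proof.
move=> e0; exists 0%N => i j _ _; apply: le_lt_trans e0.
apply: proj_norm_eq0 => A _.
by rewrite !big_cons big_nil /= addr0 mul1r mulN1r subrr.
Qed.

Definition elementary (x : X) := CompletedTensor (elementary_cauchy x).

Lemma pairing_elementary (q : X -> K) x : pairing q (elementary x) = q x.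
Proof.
rewrite /pairing /=; under eq_fun do rewrite big_seq1 mul1r.
exact: lim_cst.
Qed.

Lemma continuous_delta (x : X) :
  continuous (fun q : weak_star_ball => (val (q : unit_ball) x : K)).
Proof.
rewrite (_ : (fun _ => _) = (fun g : {ptws completed_tensor -> K} => g (elementary x))
    \o (fun q : weak_star_ball => pairing (val (q : unit_ball)))); last first.
  by apply/funext => q /=; rewrite pairing_elementary.
move=> q; apply: continuous_comp; first exact: initial_continuous.
exact: (@proj_continuous _ (fun=> K) (elementary x)).
Qed.

Definition delta (x : X) : continuousType weak_star_ball K :=
  mkcts (@continuous_delta x).

End weak_star.
Arguments weak_star_ball {R k} m X.
Arguments delta {R k} m {X} x.

Notation borel T := (g_sigma_algebraType (@open T)).

Definition regular_measure (R : realType) (T : ptopologicalType)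
    (mu : {measure set (borel T) -> \bar R}) :=
  forall A : set (borel T), measurable A ->
    mu A = ereal_inf [set mu U | U in [set U | @open T U /\ A `<=` U]] /\
    mu A = ereal_sup [set mu C | C in [set C | @compact T C /\ C `<=` A]].

Section canonical_inclusion.
Context (R : realType) (k : scalar_kind) (T : ptopologicalType).
Local Notation K := (scalar_field R k).
Variables (mu : {measure set (borel T) -> \bar R}) (p : R) (p1 : 1 <= p).

Local Open Scope quotient_scope.

(* [insubd] only falls back to 0 on functions outside L_p; by [j_pE] this
   never happens when T is compact and mu is finite. *)
Definition j_p (f : continuousType T K) : Lp k mu p1 :=
  \pi_(Lp k mu p1) (insubd (0 : Lp_pre k mu p1) (f : T -> K^o)).

Lemma continuous_Lp_fun (f : continuousType T K) :
  compact [set: T] -> (mu setT < +oo)%E -> Lp_fun mu p (f : T -> K^o).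
Proof.
move=> cT mufin; have mcont (g : T -> R) : continuous g ->
    measurable_fun [set: borel T] (g : borel T -> R).
  move=> /continuousP cg; apply: (measurability _ (RGenOpens.measurableE R)).
  move=> _ [_ [a [b ->] <-]]; rewrite setTI.
  by apply: sub_sigma_algebra; apply: cg; exact: interval_open.
have cf : continuous (f : T -> K) by exact: cts_fun.
have mf : scalar_measurable (f : borel T -> K).
  split; apply: mcont => x; apply: continuous_comp; do ?exact: cf.
    exact: continuous_re.
  exact: continuous_im.
split=> //; have crf : continuous (fun x : T => rnorm (f x)).
  by move=> x; apply: continuous_comp; [exact: cf|exact: continuous_rnorm].
have /compact_bounded[M [_ /(_ (M + 1))]] : compact ((fun x : T => rnorm (f x)) @` setT).
  by apply: continuous_compact => //; exact: continuous_subspaceT.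
rewrite ltrDl ltr01 => /(_ isT) bM; set N := M + 1 in bM.
have fN x : rnorm (f x) <= N.
  by apply: le_trans (ler_norm _) _; apply: bM; exists x.
apply: (@le_lt_trans _ _ ('N[mu]_p%:E [EFin \o (fun=> N)])%E).
  apply: le_Lnorm => //; first exact: measurable_rnorm.
  by move=> x; rewrite rnorm_ge0 fN.
rewrite unlock; apply: poweR_lty.
rewrite (_ : (fun _ => _) = (cst (`|N| `^ p)%:E)); last by apply/funext.
by rewrite integral_cst//; apply: lte_mul_pinfty.
Qed.

Lemma j_pE (f : continuousType T K) :
  compact [set: T] -> (mu setT < +oo)%E ->
  {ae mu, forall x, repr (j_p f) x = f x}.
Proof.
move=> cT mufin.
apply: (@filterS _ _ _ _ _ _ (Lp_repr (insubd (0 : Lp_pre k mu p1) (f : T -> K^o)))) => x ->.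
rewrite /insubd insubT//=.
by rewrite /Lp_pred inE; exact: continuous_Lp_fun.
Qed.

End canonical_inclusion.
Arguments j_p {R k T} mu {p} p1 f.

(* Main.v *)
Require Import Defs.
From HB Require Import structures.
From mathcomp Require Import all_boot all_order all_algebra.
From mathcomp Require Import fingroup perm complex.
From mathcomp Require Import all_classical all_reals all_analysis.
From mathcomp Require Import measurable_realfun ring lra.

Import Order.TTheory GRing.Theory Num.Theory.
Import numFieldNormedType.Exports.

Local Open Scope classical_set_scope.
Local Open Scope ring_scope.

Set Implicit Arguments.
Unset Strict Implicit.
Unset Printing Implicit Defensive.

(** The polynomial [P] and the map [delta] are compared through the symmetric
    tensors [s = sum_i l_i x_i (x) ... (x) x_i]: such an [s] has an image
    [tensor_map P s = sum_i l_i P x_i] in [Y], and an image [Lp_tensor mu s] in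
    [L_p(mu)], the class of the function [q |-> sum_i l_i q(x_i)] on the ball
    of polynomials. The polynomial [P] factors through [mu] exactly when
    [|tensor_map P s| <= C |Lp_tensor mu s|] for all [s].

    If [P] factors, this inequality holds because [v_0] is bounded on [G_p]
    ([bounded_on_subspace]), and summing its [p]-th powers over finitely many
    tensors and bounding the integral of the sum by its supremum over the ball
    shows that [P] is summing ([factorization_summing]).

    Conversely, let [P] be summing. For a finite family [l] of tensors let
    [gap l q = sum_(s in l) (C^p |s(q)|^p - |tensor_map P s|^p)]. The gaps form a
    convex cone of continuous functions on the ball ([gap_cat], [gap_scale]), and
    the summing inequality says that the supremum of each of them is nonnegative
    ([gap_sup_ge0]). Hence [g |-> inf_l sup (g + gap l)] is a sublinear functional
    on the continuous functions, and Hahn-Banach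
    ([sublinear_dominates_linear]) gives a linear functional below it. That
    functional is positive, normalized and nonnegative on the gaps, so the
    regular probability that represents it ([riesz_regular_probability])
    satisfies the domination inequality ([pietsch_domination]). Then
    [Lp_tensor mu s |-> tensor_map P s] is a well-defined bounded operator, and
    it extends to the closure of its domain since [Y] is complete
    ([extend_by_density]).

    The Riesz theorem requires the ball to be compact and Hausdorff for the
    weak-star topology. Compactness ([weak_star_ball_compact]) is proved with
    ultrafilters: the polynomials of the ball converge pointwise along an
    ultrafilter, and the limit is a polynomial because the polarization formula
    ([polarE]) expresses the symmetric multilinear map of a polynomial [q] by
    finitely many values of [q]. The limit is continuous because it is bounded
    on the unit ball ([diag_continuous]), and pointwise convergence on the ball
    implies weak-star convergence because the pairing with an element of the
    completed tensor product is a uniform limit of pairings with tensors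
    ([pairing_approx]). *)

(** * Sublinear and linear functionals *)

Section hahn_banach.
Context {R : realType} {V : lmodType R}.
Variable D : set V.
Hypotheses (D0 : D 0) (Dlin : forall a x y, D x -> D y -> D (a *: x + y)).

(** Subadditive and positively homogeneous on [D]; one inequality suffices for
    homogeneity. *)
Definition sublinear_on (N : V -> R) :=
  (forall x y, D x -> D y -> N (x + y) <= N x + N y) /\
  (forall a x, 0 <= a -> D x -> N (a *: x) <= a * N x).

Let DD x y : D x -> D y -> D (x + y).
Proof. by move=> Dx Dy; have := Dlin 1 Dx Dy; rewrite scale1r. Qed.

Let DZ a x : D x -> D (a *: x).
Proof. by move=> Dx; have := Dlin a Dx D0; rewrite addr0. Qed.

Let DN x : D x -> D (- x).
Proof. by move=> Dx; rewrite -scaleN1r; exact: DZ. Qed.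

Lemma sublinear0 N : sublinear_on N -> N 0 = 0.
Proof.
move=> [ND NZ]; apply/eqP; rewrite eq_le; apply/andP; split.
  by have := NZ 0 0 (lexx _) D0; rewrite scale0r mul0r.
by have := ND 0 0 D0 D0; rewrite addr0 -lerBlDr subrr.
Qed.

Lemma sublinearZ N a x : sublinear_on N -> 0 <= a -> D x -> N (a *: x) = a * N x.
Proof.
move=> sN; rewrite le_eqVlt => /predU1P[<-|a0] Dx.
  by rewrite scale0r mul0r (sublinear0 sN).
have [_ NZ] := sN; apply/eqP; rewrite eq_le NZ ?(ltW a0)//=.
rewrite -ler_pdivlMl//; have := NZ a^-1 (a *: x).
rewrite scalerA mulVf ?gt_eqF// scale1r; apply; last exact: DZ.
by rewrite invr_ge0 ltW.
Qed.

Lemma sublinearN N x : sublinear_on N -> D x -> - N (- x) <= N x.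
Proof.
move=> sN Dx; have [ND _] := sN.
by rewrite lerNl -subr_ge0 opprK -(sublinear0 sN) -(addNr x); apply/ND/Dx/DN.
Qed.

Let le_on (N M : V -> R) := forall x, D x -> N x <= M x.

(** The infimum of a chain of sublinear functionals is sublinear. *)
Lemma sublinear_chain (p : V -> R) (A : set (V -> R)) : sublinear_on p ->
  (forall N, A N -> sublinear_on N /\ le_on N p) ->
  (forall N M, A N -> A M -> le_on N M \/ le_on M N) -> A !=set0 ->
  let I x := inf [set N x | N in A] in
  [/\ sublinear_on I, le_on I p & forall N, A N -> le_on I N].
Proof.
move=> sp Ap Atot [N0 AN0] I.
have lbI x : D x -> lbound [set N x | N in A] (- p (- x)).
  move=> Dx _ [N AN <-]; have [sN Np] := Ap _ AN.
  apply: le_trans (sublinearN sN Dx).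
  by rewrite lerN2; exact/Np/DN.
have IN N : A N -> le_on I N.
  move=> AN x Dx; apply: ge_inf; last by exists N.
  by exists (- p (- x)); exact: lbI.
have Ilb x r : (forall N, A N -> r <= N x) -> r <= I x.
  move=> rN; apply: lb_le_inf; first by exists (N0 x); exists N0.
  by move=> _ [N AN <-]; exact: rN.
split=> //; last by move=> x Dx; apply: le_trans (IN _ AN0 _ Dx) _; exact: (Ap _ AN0).2.
split=> [x y Dx Dy|a x a0 Dx].
  rewrite -lerBlDr; apply: (Ilb _ _) => M AM; rewrite lerBlDl -lerBlDr.
  apply: (Ilb _ _) => N AN; rewrite lerBlDr.
  have [NM|MN] := Atot _ _ AN AM.
    apply: le_trans (IN _ AN _ (DD Dx Dy)) _.
    have [[ND _] _] := Ap _ AN; apply: le_trans (ND _ _ Dx Dy) _.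
    by rewrite addrC lerD2l NM.
  apply: le_trans (IN _ AM _ (DD Dx Dy)) _.
  have [[MD _] _] := Ap _ AM; apply: le_trans (MD _ _ Dx Dy) _.
  by rewrite addrC lerD2r MN.
move: a0; rewrite le_eqVlt => /predU1P[<-|a0].
  rewrite scale0r mul0r; apply: le_trans (IN _ AN0 _ D0) _.
  by rewrite (sublinear0 (Ap _ AN0).1).
rewrite -ler_pdivrMl//; apply: (Ilb _ _) => N AN; rewrite ler_pdivrMl//.
apply: le_trans (IN _ AN _ (DZ _ Dx)) _.
by rewrite (sublinearZ (Ap _ AN).1)// ltW.
Qed.

(** A minimal sublinear functional is additive: the sublinear functional
    [x |-> inf_(t >= 0) (N (x + t y) - t N y)] lies below [N], hence is at least [N]
    by minimality, and it is at most [N (x + y) - N y]. *)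
Lemma minimal_sublinear (N : V -> R) : sublinear_on N ->
  (forall M, sublinear_on M -> le_on M N -> le_on N M) ->
  forall x y, D x -> D y -> N (x + y) = N x + N y.
Proof.
move=> sN Nmin x y Dx Dy; have [ND NZ] := sN.
pose S z := [set N (z + t *: y) - t * N y | t in [set t | 0 <= t]].
pose M z := inf (S z).
have lbS z : D z -> lbound (S z) (- N (- z)).
  move=> Dz _ [t /= t0 <-]; rewrite -(sublinearZ sN)// lerBrDr addrC lerBlDr.
  have := ND _ _ (DD Dz (DZ t Dy)) (DN Dz).
  by rewrite [z + _]addrC addrK.
have MS z t : D z -> 0 <= t -> M z <= N (z + t *: y) - t * N y.
  move=> Dz t0; apply: ge_inf; last by exists t.
  by exists (- N (- z)); exact: lbS.
have Mlb z r : (forall t, 0 <= t -> r <= N (z + t *: y) - t * N y) -> r <= M z.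
  move=> rS; apply: lb_le_inf; last by move=> _ [t t0 <-]; exact: rS.
  by exists (N (z + 0 *: y) - 0 * N y); exists 0 => /=.
have sM : sublinear_on M.
  split=> [u v Du Dv|a u a0 Du].
    rewrite -lerBlDr; apply: (Mlb _ _) => t t0; rewrite lerBlDl -lerBlDr.
    apply: (Mlb _ _) => s s0; rewrite lerBlDr.
    apply: le_trans (MS _ (t + s) (DD Du Dv) (addr_ge0 t0 s0)) _.
    rewrite scalerDl mulrDl opprD !addrA.
    have := ND (u + t *: y) (v + s *: y) (DD Du (DZ _ Dy)) (DD Dv (DZ _ Dy)).
    rewrite addrACA !addrA => H.
    apply: (@le_trans _ _ (N (u + t *: y) + N (v + s *: y) - t * N y - s * N y)).
      by rewrite !lerD2r.
    by rewrite le_eqVlt; apply/orP; left; apply/eqP; ring.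
  move: a0; rewrite le_eqVlt => /predU1P[<-|a0].
    rewrite scale0r mul0r; apply: le_trans (MS _ 0 D0 (lexx _)) _.
    by rewrite scale0r addr0 mul0r subr0 (sublinear0 sN).
  rewrite -ler_pdivrMl//; apply: (Mlb _ _) => t t0; rewrite ler_pdivrMl//.
  apply: le_trans (MS _ (a * t) (DZ _ Du) (mulr_ge0 (ltW a0) t0)) _.
  rewrite -scalerA -scalerDr mulrBr mulrA lerD2r; apply: NZ; first exact: ltW.
  exact: DD (DZ _ _).
apply/eqP; rewrite eq_le ND//=.
have MN : le_on M N.
  by move=> z Dz; have := MS z 0 Dz (lexx _); rewrite scale0r mul0r addr0 subr0.
have := le_trans (Nmin _ sM MN _ Dx) (MS x 1 Dx ler01).
by rewrite scale1r mul1r lerBrDr.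
Qed.

(** Hahn-Banach: below every sublinear functional there is a linear one. *)
Theorem sublinear_dominates_linear (p : V -> R) : sublinear_on p ->
  exists L : V -> R, (forall x, D x -> L x <= p x) /\
    forall a x y, D x -> D y -> L (a *: x + y) = a * L x + L y.
Proof.
move=> sp; pose T := {N : V -> R | sublinear_on N /\ le_on N p}.
pose mkT N sN Np : T := exist _ N (conj sN Np).
pose t0 := mkT p sp (fun x _ => lexx _).
pose r (N M : T) : bool := `[< le_on (sval M) (sval N) >].
have [|||[N [sN Np]] Nmax] := @ZL_preorder T t0 r.
- by move=> N; apply/asboolP => x _.
- move=> N M P /asboolP NM /asboolP MP; apply/asboolP => x Dx.
  exact: le_trans (MP _ Dx) (NM _ Dx).
- move=> A Atot; have [->|/set0P[N0 AN0]] := eqVneq A set0; first by exists t0 => s [].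
  have [|||sI Ip IA] := @sublinear_chain p [set sval N | N in A] sp.
  + by move=> _ [[N [sN Np]] _ <-].
  + move=> _ _ [N AN <-] [M AM <-].
    by have [/asboolP|/asboolP] := Atot _ _ AN AM; [right|left].
  + by exists (sval N0); exists N0.
  exists (mkT _ sI Ip) => M AM; apply/asboolP; apply: IA.
  by exists M.
have Nadd := minimal_sublinear sN.
have {}Nadd x y : D x -> D y -> N (x + y) = N x + N y.
  apply: Nadd => M sM MN; have Mp : le_on M p.
    by move=> z Dz; exact: le_trans (MN _ Dz) (Np _ Dz).
  have := Nmax (mkT _ sM Mp); rewrite /r /=.
  by move=> /(_ (introT (asboolP _) MN)) /asboolP.
have NN x : D x -> N (- x) = - N x.
  move=> Dx; apply/eqP; rewrite eq_sym -subr_eq0 -opprD oppr_eq0 -Nadd//.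
    by rewrite subrr (sublinear0 sN).
  exact: DN.
exists N; split=> // a x y Dx Dy; rewrite Nadd//; last exact: DZ.
congr (_ + _); have [a0|a0] := leP 0 a; first exact: sublinearZ.
have aN : 0 <= - a by rewrite oppr_ge0 ltW.
have := NN _ (DZ (- a) Dx).
by rewrite (sublinearZ sN)// scaleNr opprK mulNr opprK.
Qed.

End hahn_banach.

(** * Regular probabilities from positive functionals *)

Lemma continuous_borel_measurable {R : realType} {T : ptopologicalType} (g : T -> R) :
  continuous g -> measurable_fun [set: borel T] (g : borel T -> R).
Proof.
move=> /continuousP cg; apply: (measurability _ (RGenOpens.measurableE R)).
move=> _ [_ [a [b ->] <-]]; rewrite setTI.
by apply: sub_sigma_algebra; apply: cg; exact: interval_open.
Qed.

Section riesz.
Context {R : realType} {T : ptopologicalType}.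
Hypotheses (cT : compact [set: T]) (hT : hausdorff_space T).
Variable L : (T -> R) -> R.
Hypotheses (Llin : forall (a : R) (f g : T -> R), continuous f -> continuous g ->
    L (a *: f + g) = a * L f + L g)
  (Lpos : forall f : T -> R, continuous f -> (forall x, 0 <= f x) -> 0 <= L f)
  (L1 : L (cst 1) = 1).
Implicit Types (U V : set T) (f g : T -> R).

Let ccst (a : R) : continuous (cst a : T -> R).
Proof. by move=> x; exact: cvg_cst. Qed.

Let cD f g : continuous f -> continuous g -> continuous (f + g).
Proof. by move=> cf cg x; apply: cvgD; [exact: cf|exact: cg]. Qed.

Let cB f g : continuous f -> continuous g -> continuous (f - g).
Proof. by move=> cf cg x; apply: cvgB; [exact: cf|exact: cg]. Qed.

Let LD f g : continuous f -> continuous g -> L (f + g) = L f + L g.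
Proof. by move=> cf cg; have := Llin 1 cf cg; rewrite scale1r mul1r. Qed.

Let L0 : L (cst 0) = 0.
Proof.
have := LD (@ccst 0) (@ccst 0); rewrite (_ : cst 0 + cst 0 = cst 0 :> (T -> R)).
  by move=> /eqP; rewrite -subr_eq0 opprD addrA subrr sub0r oppr_eq0 => /eqP.
by apply/funext => x /=; rewrite [LHS]addr0.
Qed.

Let LZ a f : continuous f -> L (a *: f) = a * L f.
Proof.
move=> cf; have := Llin a cf (@ccst 0); rewrite L0 => LH.
rewrite -[RHS]addr0 -LH; congr L.
by apply/funext => x; rewrite [RHS]addr0.
Qed.

Let Lcst a : L (cst a) = a.
Proof.
rewrite -[RHS]mulr1 -L1 -LZ//; congr L.
by apply/funext => x /=; rewrite [RHS]mulr1.
Qed.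

Let Lle f g : continuous f -> continuous g -> (forall x, f x <= g x) -> L f <= L g.
Proof.
move=> cf cg fg; have -> : g = f + (g - f) by rewrite addrC subrK.
rewrite LD//; last exact: cB.
by rewrite lerDl; apply: Lpos; [exact: cB|move=> x; rewrite subr_ge0].
Qed.

(* The positive part of [f - e]. *)
Let cut (e : R) f (x : T) : R := Num.max (f x - e) 0.

Let ccut e f : continuous f -> continuous (cut e f).
Proof.
move=> cf x; apply: (@continuous_max _ _ (fun x => f x - e) (cst 0)).
  exact: cB cf (@ccst e) x.
exact: ccst.
Qed.

Let Lcut (e : R) f : 0 <= e -> continuous f -> L f <= L (cut e f) + e.
Proof.
move=> e0 cf; rewrite -[X in _ + X](Lcst e) -LD//; last exact: ccut.
apply: Lle => //; first by apply: cD => //; exact: ccut.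
by move=> x; rewrite -[leRHS]/(cut e f x + e) /cut -lerBlDr le_max lexx.
Qed.

(** Continuous functions lying between 0 and the indicator function of [U]. *)
Let bump U := [set f : T -> R | [/\ continuous f, forall x, 0 <= f x <= 1 &
  forall x, ~ U x -> f x = 0]].

(* The measure that open sets will have. *)
Let content U := sup [set L f | f in bump U].

Let bump0 U : bump U (cst 0).
Proof. by split=> // x; rewrite lexx ler01. Qed.

Let bump_range U f : bump U f -> 0 <= L f <= 1.
Proof.
move=> [cf f01 _]; apply/andP; split.
  by apply: Lpos => // x; have /andP[] := f01 x.
by rewrite -L1; apply: Lle => // x; have /andP[] := f01 x.
Qed.

Let content_ub U f : bump U f -> L f <= content U.
Proof.
move=> bf; apply: ub_le_sup; last by exists f.
by exists 1 => _ [g /bump_range/andP[_ ?] <-].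
Qed.

Let content_le U r : (forall f, bump U f -> L f <= r) -> content U <= r.
Proof.
move=> Ur; apply: ge_sup; first by exists 0, (cst 0).
by move=> _ [f /Ur ? <-].
Qed.

Let content_ge0 U : 0 <= content U.
Proof. by rewrite -L0; apply: content_ub. Qed.

Let content_mono U V : U `<=` V -> content U <= content V.
Proof.
move=> UV; apply: content_le => f [cf f01 fU]; apply: content_ub.
by split=> // x Vx; apply: fU => /UV.
Qed.

Let content0 : content set0 = 0.
Proof.
apply/eqP; rewrite eq_le content_ge0 andbT; apply: content_le => f [_ _ f0].
by rewrite (_ : f = cst 0) ?L0//; apply/funext => x; rewrite f0.
Qed.

Let contentT : content setT = 1.
Proof.
apply/eqP; rewrite eq_le; apply/andP; split.
  by apply: content_le => f /bump_range/andP[].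
rewrite -L1; apply: content_ub; split=> [|x|x []//]; first exact: ccst.
by rewrite /= ler01 lexx.
Qed.

Let le_eps (a b : R) : (forall e : R, 0 < e -> a <= b + e) -> a <= b.
Proof. by move=> ab; apply/ler_addgt0Pr. Qed.

Let closed_level f e : continuous f -> closed [set x | e <= f x].
Proof.
by move=> /continuous_closedP cf; apply: (cf [set y | e <= y]); exact: closed_ge.
Qed.

Let open_level f e : continuous f -> open [set x | e < f x].
Proof.
by move=> /continuousP cf; apply: (cf [set y | e < y]); exact: open_gt.
Qed.

(* The part of [f] that is not carried by [V] lives, up to [e], on the closed
   set [{f >= e} \ V] contained in [U]; Urysohn's lemma splits it off. *)
Let contentU U V : open U -> open V -> content (U `|` V) <= content U + content V.
Proof.
move=> oU oV; apply: content_le => f [cf f01 fUV]; apply: le_eps => e e0.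
pose A := [set x | e <= f x] `&` ~` V.
have clA : closed A by apply: closedI; [exact: closed_level|exact: open_closedC].
have AU : (~` U) `&` A = set0.
  rewrite -subset0 => x [Ux [/= fx Vx]]; move: fx.
  by rewrite fUV ?leNgt ?e0// => -[].
have /(normal_separatorP (R := R)).1/(_ _ _ (open_closedC oU) clA AU) :=
  compact_normal hT cT.
move=> /(uniform_separatorP (R := R) _ _).1 [psi [cpsi psi01 psiU psiA]].
have psi_range x : 0 <= psi x <= 1.
  by have := psi01 (psi x); rewrite /= in_itv /=; apply; exists x.
have bpsi : bump U psi by split=> // x Ux; apply: psiU; exists x.
pose g x := Num.max (cut e f x - psi x) 0.
have bg : bump V g.
  split.
  - move=> x; apply: (@continuous_max _ _ (cut e f - psi) (cst 0)).
      by apply: cB => //; exact: ccut.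
    exact: ccst.
  - move=> x; rewrite /g le_max lexx orbT /= ge_max ler01 andbT /cut.
    have /andP[? ?] := f01 x; have /andP[? ?] := psi_range x.
    rewrite lerBlDr ge_max; apply/andP; split; lra.
  - move=> x Vx; rewrite /g /cut; have /andP[? ?] := f01 x.
    have /andP[? ?] := psi_range x.
    have [fe|fe] := leP e (f x).
      have -> : psi x = 1 by apply: psiA; exists x.
      by apply/max_idPr; rewrite lerBlDr ge_max; apply/andP; split; lra.
    have -> : Num.max (f x - e) 0 = 0 by apply/max_idPr; lra.
    by apply/max_idPr; lra.
have [cg _ _] := bg.
apply: (@le_trans _ _ (L (psi + g) + e)).
  apply: le_trans (Lcut (ltW e0) cf) _; rewrite lerD2r.
  apply: Lle; [exact: ccut|exact: cD|move=> x].
  by rewrite -[leRHS]/(psi x + g x) /g -lerBlDl le_max lexx.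
by rewrite lerD2r LD// lerD// content_ub.
Qed.

Let content_bigU (F : (set T)^nat) n : (forall i, open (F i)) ->
  content (\big[setU/set0]_(i < n) F i) <= \sum_(i < n) content (F i).
Proof.
move=> oF; elim: n => [|n IHn]; first by rewrite !big_ord0 content0.
rewrite !big_ord_recr /=; apply: le_trans (contentU _ _) _ => //.
  by apply: big_ind => [|A B|i _]; [exact: open0|exact: openU|exact: oF].
by rewrite lerD2r.
Qed.

(* For a bump [f] carried by the union, the compact set [{f >= e / 2}] is covered
   by finitely many of the sets. *)
Let content_bigcup (F : (set T)^nat) : (forall i, open (F i)) ->
  ((content (\bigcup_n F n))%:E <= \sum_(i <oo) (content (F i))%:E)%E.
Proof.
move=> oF; apply/lee_addgt0Pr => /= e e0.
have [n Hn] : exists n, content (\bigcup_n F n) <= \sum_(i < n) content (F i) + e.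
  have [f [bf fe]] : exists f, bump (\bigcup_n F n) f /\
      content (\bigcup_n F n) <= L f + e / 2.
    apply: contrapT => /forallNP H.
    have : content (\bigcup_n F n) <= content (\bigcup_n F n) - e / 2.
      apply: content_le => f bf; have /not_andP[/(_ bf)[]|/negP] := H f.
      by rewrite -ltNge => /ltW; lra.
    lra.
  have [cf f01 fF] := bf.
  pose C := [set x | e / 2 <= f x].
  have clC : closed C by exact: closed_level.
  have cC : compact C by exact: subclosed_compact clC cT _.
  move: cC; rewrite compact_cover => /(_ nat setT F (fun i _ => oF i)) [].
    move=> x; rewrite /C /= => fx; apply: contrapT => Fx.
    by move: fx; rewrite fF// leNgt divr_gt0.
  move=> D _ CD; pose n := (\max_(i <- finmap.enum_fset D) i).+1.
  exists n; apply: le_trans fe _.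
  have e20 : 0 <= e / 2 by rewrite divr_ge0// ltW.
  apply: le_trans (lerD (Lcut e20 cf) (lexx _)) _.
  rewrite -addrA -splitr lerD2r.
  apply: le_trans (content_bigU _ oF); apply: content_ub; split.
  - exact: ccut.
  - move=> x; rewrite /cut le_max lexx orbT /= ge_max ler01 andbT.
    by have /andP[? ?] := f01 x; lra.
  - move=> x Fx; apply/max_idPr; rewrite leNgt subr_gt0; apply/negP => /ltW fx.
    apply: Fx; have [i iD Fix] := CD _ fx.
    rewrite -bigcup_mkord; exists i => //=.
    by rewrite /n ltnS; apply: leq_bigmax_seq.
apply: le_trans (_ : (\sum_(i < n) content (F i) + e)%:E <= _)%E.
  by rewrite lee_fin.
rewrite EFinD leeD2r// -sumEFin -(big_mkord xpredT (fun i => (content (F i))%:E)).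
by apply: nneseries_lim_ge => i _ _; rewrite lee_fin.
Qed.

(* The outer measure induced by the contents of the open sets. *)
Let outer A := inf [set content U | U in [set U | open U /\ A `<=` U]].

Let outer_lb A U : open U -> A `<=` U -> outer A <= content U.
Proof.
move=> oU AU; apply: ge_inf; last by exists U.
by exists 0 => _ [V _ <-].
Qed.

Let outer_ge A r : (forall U, open U -> A `<=` U -> r <= content U) -> r <= outer A.
Proof.
move=> rA; apply: lb_le_inf; last by move=> _ [U [oU AU] <-]; exact: rA.
by exists (content setT), setT => //; split=> //; exact: openT.
Qed.

Let outer_ge0 A : 0 <= outer A.
Proof. exact: outer_ge. Qed.

Let outer_open U : open U -> outer U = content U.
Proof.
move=> oU; apply/eqP; rewrite eq_le outer_lb//=.
by apply: outer_ge => V _; exact: content_mono.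
Qed.

Let outer_mono A B : A `<=` B -> outer A <= outer B.
Proof.
by move=> AB; apply: outer_ge => U oU BU; apply: outer_lb => // x /AB/BU.
Qed.

Let outer_approx A (e : R) : 0 < e ->
  exists U, [/\ open U, A `<=` U & content U <= outer A + e].
Proof.
move=> e0; apply: contrapT => /forallNP H.
have : outer A + e <= outer A.
  apply: outer_ge => U oU AU; rewrite leNgt; apply/negP => /ltW UA.
  by apply: (H U).
lra.
Qed.

Let rho (A : set T) : \bar R := (outer A)%:E.

Let rho0 : rho set0 = 0%E.
Proof. by rewrite /rho outer_open ?content0//; exact: open0. Qed.

Let rho_ge0 A : (0 <= rho A)%E.
Proof. by rewrite lee_fin. Qed.

Let rho_mono : {homo rho : A B / A `<=` B >-> (A <= B)%E}.
Proof. by move=> A B AB; rewrite lee_fin; exact: outer_mono. Qed.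

Let rho_subadditive : sigma_subadditive rho.
Proof.
move=> F; apply/lee_addgt0Pr => /= e e0.
have /choice[U HU] n : exists U, [/\ open U, F n `<=` U &
    content U <= outer (F n) + e / (2 ^ n.+1)%:R].
  by apply: outer_approx; rewrite divr_gt0// ltr0n expn_gt0.
have oU n : open (U n) by case: (HU n).
apply: (@le_trans _ _ (content (\bigcup_n U n))%:E).
  rewrite lee_fin; apply: outer_lb; first exact: bigcup_open.
  by apply: subset_bigcup => n _; case: (HU n).
apply: le_trans (content_bigcup oU) _.
apply: (@le_trans _ _ (\sum_(i <oo) (rho (F i) + (e / (2 ^ i.+1)%:R)%:E))%E); last first.
  by apply: epsilon_trick => [n|]; [exact: rho_ge0|exact: ltW].
apply: lee_nneseries => [n _|n _]; first by rewrite lee_fin.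
by rewrite -EFinD lee_fin; case: (HU n).
Qed.

HB.instance Definition _ := isOuterMeasure.Build R T rho
  rho0 rho_ge0 rho_mono rho_subadditive.

(* For [X] included in an open set [V], a bump [g] carried by [V `&` U] and a
   bump [h] carried by [V `\` {g >= e}] have, after lowering [g] by [e],
   disjoint supports, so that their sum is a bump carried by [V]. *)
Let open_caratheodory U : open U -> rho.-caratheodory U.
Proof.
move=> oU; apply: le_caratheodory_measurable => X.
rewrite -EFinD lee_fin; apply: outer_ge => V oV XV.
apply: (@le_trans _ _ (content (V `&` U) + outer (X `&` ~` U))).
  rewrite lerD2r; apply: outer_lb; first exact: openI.
  exact: setSI.
rewrite -lerBrDr; apply: content_le => g [cg g01 gVU].
rewrite lerBrDr; apply: le_eps => e e0.
pose W := V `&` ~` [set x | e <= g x].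
have oW : open W by apply: openI => //; exact/closed_openC/closed_level.
apply: (@le_trans _ _ (L g + content W)).
  rewrite lerD2l; apply: outer_lb => // x [Xx Ux]; split; first exact: XV.
  by rewrite /= gVU ?leNgt ?e0// => -[].
rewrite -lerBrDl; apply: content_le => h [ch h01 hW].
rewrite lerBrDl; apply: le_trans (lerD (Lcut (ltW e0) cg) (lexx _)) _.
rewrite addrAC lerD2r -LD//; last exact: ccut.
apply: content_ub; split; first by apply: cD => //; exact: ccut.
- move=> x; rewrite -[(_ + _) x]/(cut e g x + h x) /cut.
  have /andP[? ?] := g01 x; have /andP[? ?] := h01 x.
  have [eg|ge] := leP e (g x).
    rewrite hW; last by move=> [_]; exact.
    rewrite addr0 (max_idPl _) ?subr_ge0//; apply/andP; split; lra.
  by rewrite (max_idPr _) ?add0r; [apply/andP; split|lra].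
- move=> x Vx; rewrite -[(_ + _) x]/(cut e g x + h x) /cut.
  rewrite gVU; last by case.
  rewrite hW ?addr0; last by case.
  by apply/max_idPr; lra.
Qed.

Let borel_caratheodory (A : set (borel T)) : measurable A -> rho.-caratheodory A.
Proof.
move: A; apply: smallest_sub.
  split.
  - exact: caratheodory_measurable_set0.
  - by move=> A mA; rewrite setTD; exact: caratheodory_measurable_setC.
  - exact: caratheodory_measurable_bigcup.
exact: open_caratheodory.
Qed.

(* [rho] as a set function on the Borel sets. *)
Let rhob : set (borel T) -> \bar R := rho.

Let rhob_sigma_additive : semi_sigma_additive rhob.
Proof.
move=> F mF tF mUF.
apply: (@caratheodory_measure_sigma_additive R T rho) => //.
- by move=> i; apply: borel_caratheodory; exact: mF.
- exact: borel_caratheodory.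
Qed.

HB.instance Definition _ := isMeasure.Build _ (borel T) R rhob
  rho0 rho_ge0 rhob_sigma_additive.

Let rhobT : rhob setT = 1%E.
Proof. by rewrite /rhob /rho outer_open ?contentT//; exact: openT. Qed.

HB.instance Definition _ := Measure_isProbability.Build _ (borel T) R rhob rhobT.

Let outerC A : rho.-caratheodory A -> outer A = 1 - outer (~` A).
Proof.
have oT : outer setT = 1 by rewrite outer_open ?contentT//; exact: openT.
move=> /(_ setT); rewrite !setTI => /(congr1 fine) /=; rewrite oT => ->.
by rewrite addrK.
Qed.

Let rhob_regular : regular_measure rhob.
Proof.
move=> A mA; split; apply/eqP; rewrite eq_le; apply/andP; split.
- by apply: le_ereal_inf_tmp => _ [U [oU AU] <-]; exact: rho_mono.
- apply/lee_addgt0Pr => /= e e0; have [U [oU AU UA]] := outer_approx A e0.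
  apply: (@le_trans _ _ (rhob U)); last by rewrite -EFinD lee_fin outer_open.
  by apply: ge_ereal_inf; exists (rhob U) => //; exists U.
- apply/lee_addgt0Pr => /= e e0; have [U [oU AU UA]] := outer_approx (~` A) e0.
  apply: (@le_trans _ _ (rhob (~` U) + e%:E)).
    rewrite -EFinD lee_fin (outerC (borel_caratheodory mA)).
    have := outerC (open_caratheodory oU); rewrite outer_open//; lra.
  rewrite leeD2r//; apply: le_ereal_sup_tmp.
  exists (rhob (~` U)) => //; exists (~` U) => //; split.
    exact: subclosed_compact (open_closedC oU) cT _.
  by move=> x Ux; apply: contrapT => /AU.
- by apply: ge_ereal_sup => _ [C [cC CA] <-]; exact: rho_mono.
Qed.

(* The function [f] truncated at height [n e]. *)
Let capped f (e : R) n (x : T) : R := Num.min (f x) (e *+ n).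

Let ccapped f e n : continuous f -> continuous (capped f e n).
Proof.
move=> cf x; apply: (@continuous_min _ _ f (cst (e *+ n))); first exact: cf.
exact: ccst.
Qed.

(* Layer cake: [f] is cut into slices of height [e]. *)
Let L_layers f (e : R) n : continuous f -> (forall x, 0 <= f x) -> 0 < e ->
  L (capped f e n) <= \sum_(i < n) e * content [set x | e *+ i < f x].
Proof.
move=> cf f0 e0; elim: n => [|n IHn].
  rewrite big_ord0 -L0; apply: Lle; [exact: ccapped|exact: ccst|move=> x].
  by rewrite /capped mulr0n ge_min lexx orbT.
pose g := e^-1 *: (capped f e n.+1 - capped f e n).
have cg0 : continuous (capped f e n.+1 - capped f e n).
  by apply: cB; exact: ccapped.
have cg : continuous g by move=> x; apply: cvgZr; exact: cg0.
have gE x : g x = e^-1 * (Num.min (f x) (e *+ n.+1) - Num.min (f x) (e *+ n)).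
  by [].
have bg : bump [set x | e *+ n < f x] g.
  split=> // x; rewrite gE mulrS.
    rewrite ler_pdivlMl// mulr0 ler_pdivrMl// mulr1.
    by have [?|?] := leP (f x) (e + e *+ n); have [?|?] := leP (f x) (e *+ n);
      apply/andP; split; lra.
  move=> /= /negP; rewrite -leNgt => fx.
  have [?|?] := leP (f x) (e + e *+ n); last lra.
  by rewrite (min_idPl fx) subrr mulr0.
rewrite big_ord_recr /=; apply: le_trans (lerD IHn (_ : e * L g <= _)); last first.
  by rewrite ler_pM2l//; exact: content_ub.
rewrite -LZ// -LD//; last 2 first.
- exact: ccapped.
- by move=> x; apply: cvgZr; exact: cg.
rewrite scalerA mulfV ?gt_eqF// scale1r addrC subrK.
by [].
Qed.

Let sum_layers (a e : R) n : 0 < e -> 0 <= a ->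
  \sum_(i < n) e * (e *+ i < a)%R%:R <= Num.min (a + e) (e *+ n).
Proof.
move=> e0 a0; elim: n => [|n IHn].
  by rewrite big_ord0 mulr0n le_min lexx andbT addr_ge0// ltW.
rewrite big_ord_recr /= mulrS; move: IHn; rewrite !le_min => /andP[? ?].
by have [?|?] := ltP (e *+ n) a; rewrite ?mulr1 ?mulr0; apply/andP; split; lra.
Qed.

Let L_le_integral f : continuous f -> (forall x, 0 <= f x) ->
  ((L f)%:E <= \int[rhob]_x (f x)%:E)%E.
Proof.
move=> cf f0.
have [M fM] : exists M, forall x, f x <= M.
  have /compact_bounded[M [_ /(_ (M + 1))]] : compact (f @` setT).
    by apply: continuous_compact => //; exact: continuous_subspaceT.
  rewrite ltrDl ltr01 => /(_ isT) bM; exists (M + 1) => x.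
  by apply: le_trans (ler_norm _) _; apply: bM; exists x.
apply/lee_addgt0Pr => /= e e0.
have [n Mn] : exists n, M <= e *+ n.
  exists (Num.trunc (M / e)).+1; rewrite -mulr_natl -ler_pdivrMr// ltW//.
  exact: truncnS_gt.
have fE : f = capped f e n.
  by apply/funext => x; rewrite /capped (min_idPl (le_trans (fM x) Mn)).
apply: (@le_trans _ _ (\sum_(i < n) e * content [set x | e *+ i < f x])%:E).
  by rewrite [X in L X]fE lee_fin; exact: L_layers.
have mA i : measurable ([set x | e *+ i < f x] : set (borel T)).
  by apply: sub_sigma_algebra; exact: open_level.
have mf : measurable_fun [set: borel T] (fun x => (f x)%:E).
  by apply/measurable_EFinP; exact: continuous_borel_measurable.
have indE i x : (e *+ i < f x)%R%:R = \1_[set x | e *+ i < f x] x :> R.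
  by rewrite indicE; congr ((nat_of_bool _)%:R); apply/idP/idP; rewrite inE.
have mslice i : measurable_fun [set: borel T] (fun x => (e * (e *+ i < f x)%R%:R)%:E).
  apply/measurable_EFinP; apply: measurable_funM => //.
  by under eq_fun do rewrite indE; exact: measurable_indic.
have -> : (\sum_(i < n) e * content [set x | e *+ i < f x])%:E =
    (\int[rhob]_x (\sum_(i < n) e * (e *+ i < f x)%R%:R)%:E)%E.
  under eq_integral do rewrite -sumEFin.
  rewrite ge0_integral_sum//.
  - rewrite -sumEFin; apply: eq_bigr => i _.
    under eq_integral do rewrite indE EFinM.
    rewrite ge0_integralZl_EFin//; last exact: ltW.
    + rewrite integral_indic// setIT EFinM; congr (_ * _)%E.
      by rewrite -[RHS]/(outer _)%:E outer_open//; exact: open_level.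
    + by apply/measurable_EFinP; exact: measurable_indic.
  - by move=> i x _; rewrite lee_fin mulr_ge0// ltW.
rewrite (_ : e%:E = \int[rhob]_x e%:E)%E; last first.
  rewrite integral_cst// [X in (_ * X)%E](_ : _ = 1%E) ?mule1//; exact: rhobT.
rewrite -ge0_integralD//=; last 2 first.
- by move=> x _; rewrite lee_fin.
- by move=> x _; rewrite lee_fin ltW.
apply: ge0_le_integral => //=.
- by move=> x _; rewrite lee_fin sumr_ge0// => i _; rewrite mulr_ge0// ltW.
- under eq_fun do rewrite -sumEFin.
  by apply: emeasurable_sum => i; exact: mslice.
- exact: emeasurable_funD.
- move=> x _; rewrite -EFinD lee_fin; apply: le_trans (sum_layers _ e0 (f0 x)) _.
  by rewrite ge_min lexx.
Qed.

(** Riesz representation on a compact Hausdorff space, for a normalized positive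
    linear functional on the continuous functions. Only the inequality that is
    needed is stated; applied to [c - f] for a large constant [c] it gives the
    equality. Regularity is read off the outer measure for open sets, and follows
    for compact sets by complementation. *)
Theorem riesz_regular_probability : exists mu : probability (borel T) R,
  regular_measure mu /\ forall f : T -> R, continuous f -> (forall x, 0 <= f x) ->
    ((L f)%:E <= \int[mu]_x (f x)%:E)%E.
Proof. by exists rhob; split; [exact: rhob_regular|exact: L_le_integral]. Qed.

End riesz.

(** * Multilinear maps and polarization *)

Section multilinear_theory.
Context {R : realType} {k : scalar_kind}.
Local Notation K := (scalar_field R k).

(** The family on [m + 1] indices with first value [u] and tail [x]. *)
Definition cons_fun (T : Type) m (u : T) (x : 'I_m -> T) (i : 'I_m.+1) : T :=
  if unlift ord0 i is Some j then x j else u.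

Lemma cons_funE (T : Type) m (x : 'I_m.+1 -> T) :
  x = cons_fun (x ord0) (fun i => x (lift ord0 i)).
Proof. by apply/funext => i; rewrite /cons_fun; case: unliftP => [j|] ->. Qed.

Lemma cons_fun_dfwith0 (T : Type) m (u v : T) (x : 'I_m -> T) :
  cons_fun u x = dfwith (cons_fun v x) ord0 u.
Proof.
apply/funext => i; case: (unliftP ord0 i) => [j|] ->; last first.
  by rewrite dfwithin /cons_fun unlift_none.
by rewrite dfwithout ?neq_lift// /cons_fun !liftK.
Qed.

Lemma cons_fun_dfwithS (T : Type) m (u v : T) (x : 'I_m -> T) j :
  cons_fun u (dfwith x j v) = dfwith (cons_fun u x) (lift ord0 j) v.
Proof.
apply/funext => i; case: (unliftP ord0 i) => [l|] ->; last first.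
  by rewrite dfwithout 1?eq_sym ?neq_lift// /cons_fun unlift_none.
rewrite /cons_fun liftK; have [->|jl] := eqVneq j l; first by rewrite !dfwithin.
by rewrite !dfwithout ?liftK// (inj_eq lift_inj).
Qed.

Context {X Y : lmodType K}.

Section coordinate.
Context {m : nat} {A : ('I_m -> X) -> Y} (Alin : multilinear A).

Lemma multilinearD (i : 'I_m) (x : 'I_m -> X) (u v : X) :
  A (dfwith x i (u + v)) = A (dfwith x i u) + A (dfwith x i v).
Proof. by have := Alin i x 1 u v; rewrite !scale1r. Qed.

Lemma multilinear0 (i : 'I_m) (x : 'I_m -> X) : A (dfwith x i 0) = 0.
Proof.
by have := Alin i x (-1) 0 0; rewrite scaler0 addr0 scaleN1r addNr.
Qed.

Lemma multilinearZ (i : 'I_m) (x : 'I_m -> X) (a : K) (u : X) :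
  A (dfwith x i (a *: u)) = a *: A (dfwith x i u).
Proof. by have := Alin i x a u 0; rewrite multilinear0 !addr0. Qed.

Lemma multilinear_sum (i : 'I_m) (x : 'I_m -> X) (J : finType) (z : J -> X) :
  A (dfwith x i (\sum_j z j)) = \sum_j A (dfwith x i (z j)).
Proof.
apply: (big_morph (fun u => A (dfwith x i u))); last exact: multilinear0.
exact: multilinearD.
Qed.

End coordinate.

Lemma multilinear_cons m (A : ('I_m.+1 -> X) -> Y) u :
  multilinear A -> multilinear (fun x => A (cons_fun u x)).
Proof.
move=> Alin i x a v w /=.
by rewrite !cons_fun_dfwithS; exact: Alin.
Qed.

(** Functions on [m + 1] indices are pairs of a value and a function on [m]
    indices. *)
Lemma sum_ffun_recl (J : finType) m (F : {ffun 'I_m.+1 -> J} -> Y) :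
  \sum_f F f = \sum_j \sum_(g : {ffun 'I_m -> J}) F [ffun i => cons_fun j g i].
Proof.
rewrite pair_big /= (reindex (fun p : J * {ffun 'I_m -> J} =>
  [ffun i => cons_fun p.1 p.2 i])) //=.
exists (fun f : {ffun 'I_m.+1 -> J} => (f ord0, [ffun i => f (lift ord0 i)])).
  move=> [j g] _ /=; congr (_, _).
    by rewrite ffunE /cons_fun unlift_none.
  by apply/ffunP => i; rewrite !ffunE /cons_fun liftK.
move=> f _ /=; apply/ffunP => i; rewrite ffunE /cons_fun /=.
by case: unliftP => [j|] ->//; rewrite ffunE.
Qed.

(** A multilinear map is distributed over sums in all its arguments at once. *)
Lemma multilinear_expand m (A : ('I_m -> X) -> Y) (J : finType)
    (z : 'I_m -> J -> X) : multilinear A ->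
  A (fun i => \sum_j z i j) = \sum_(f : {ffun 'I_m -> J}) A (fun i => z i (f i)).
Proof.
elim: m A z => [|m IHm] A z Alin.
  rewrite (big_pred1 [ffun i : 'I_0 => match notF (ltn_ord i) with end]).
    by congr A; apply/funext => -[].
  by move=> f; apply/esym/eqP/ffunP => -[].
rewrite sum_ffun_recl [X in A X]cons_funE.
rewrite (cons_fun_dfwith0 _ 0) multilinear_sum//; apply: eq_bigr => j _.
rewrite -cons_fun_dfwith0 (IHm _ _ (multilinear_cons _ Alin)).
apply: eq_bigr => g _; congr A; apply/funext => i.
by rewrite ffunE /cons_fun; case: unliftP => [l|] ->.
Qed.

Lemma multilinear_scale m (A : ('I_m -> X) -> Y) (c : 'I_m -> K) x :
  multilinear A -> A (fun i => c i *: x i) = (\prod_i c i) *: A x.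
Proof.
elim: m A c x => [|m IHm] A c x Alin.
  by rewrite big_ord0 scale1r; congr A; apply/funext => -[].
rewrite [X in A X]cons_funE (cons_fun_dfwith0 _ 0) multilinearZ// -cons_fun_dfwith0.
rewrite (IHm _ _ _ (multilinear_cons _ Alin)) scalerA -big_ord_recl.
by rewrite -cons_funE.
Qed.

Lemma multilinear_comb m (A : ('I_m -> X) -> Y) (J : finType) (c : J -> K)
    (z : J -> X) : multilinear A ->
  A (fun=> \sum_j c j *: z j) =
    \sum_(f : {ffun 'I_m -> J}) (\prod_i c (f i)) *: A (fun i => z (f i)).
Proof.
move=> Alin; rewrite (multilinear_expand (fun _ j => c j *: z j))//.
by apply: eq_bigr => f _; rewrite multilinear_scale.
Qed.

(** The polar form of [q], up to the factor [m!]: when [q] is the diagonal of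
    the multilinear map [A], it is the sum of the [A (x_(s 1), ..., x_(s m))]
    over the permutations [s]. *)
Definition polar m (q : X -> Y) (x : 'I_m -> X) : Y :=
  \sum_(s : {ffun 'I_m -> bool}) (\prod_j (if s j then 1 else -1)) *:
    q (\sum_j (s j)%:R *: x j).

(* Inclusion-exclusion: only the surjective index maps survive. *)
Lemma inclusion_exclusion m (f : {ffun 'I_m -> 'I_m}) :
  \sum_(s : {ffun 'I_m -> bool}) (\prod_j (if s j then 1 else -1)) *
    (\prod_i (s (f i))%:R) = (injectiveb f)%:R :> K.
Proof.
have eqs (s : {ffun 'I_m -> bool}) : \prod_i (s (f i))%:R =
    \prod_j (if [exists i, f i == j] then (s j)%:R else 1) :> K.
  have [/forallP sf|] := boolP [forall i, s (f i)].
    rewrite !big1// => j _; last by rewrite sf.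
    by case: ifP => // /existsP[i /eqP <-]; rewrite sf.
  rewrite negb_forall => /existsP[i /negbTE sfi].
  rewrite (bigD1 i)//= sfi mul0r (bigD1 (f i))//= sfi.
  case: ifPn => [_|/negP[]]; first by rewrite mul0r.
  by apply/existsP; exists i.
under eq_bigr do rewrite eqs -big_split /=.
rewrite -(bigA_distr_bigA (fun j (b : bool) => (if b then 1 else -1) *
  (if [exists i, f i == j] then b%:R else 1) : K)) /=.
have [finj|] := boolP (injectiveb f).
  rewrite big1// => j _; have /injF_bij[g fg gf] := injectiveP _ finj.
  have jf : [exists i, f i == j] by apply/existsP; exists (g j); rewrite gf.
  by rewrite big_bool /= jf mul1r mulr0 addr0.
move=> ninj; have [j jf] : exists j, ~~ [exists i, f i == j].
  apply/existsP; rewrite -negb_forall; apply: contra ninj => /forallP fsurj.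
  have /choice[g gK] : forall j, exists i, f i = j.
    by move=> j; have /existsP[i /eqP] := fsurj j; exists i.
  have gf : cancel g f by [].
  have ginj := can_inj gf; apply/injectiveP.
  exact: can_inj (canF_sym gf).
by rewrite (bigD1 j)//= big_bool /= (negbTE jf) mul1r mulr1 subrr mul0r.
Qed.

Lemma polarE m (A : ('I_m -> X) -> Y) x : multilinear A ->
  polar (fun u => A (fun=> u)) x = \sum_(s : {perm 'I_m}) A (fun i => x (s i)).
Proof.
move=> Alin; rewrite /polar.
under eq_bigr do rewrite multilinear_comb// scaler_sumr.
rewrite exchange_big /=.
under eq_bigr => f _ do
  (under eq_bigr do rewrite scalerA; rewrite -scaler_suml inclusion_exclusion).
rewrite (bigID (fun f : {ffun 'I_m -> 'I_m} => injectiveb f)) /= addrC big1 ?add0r.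
  rewrite (reindex (@pval _)) /=; last first.
    pose in_Sn := insubd (1%g : {perm 'I_m}).
    by exists in_Sn => /= f Uf; first apply: val_inj; apply: insubdK.
  apply: eq_big => /= [s|s injs]; first by rewrite (valP s).
  by rewrite (valP s) scale1r; congr A; apply/funext => i; rewrite pvalE.
by move=> f /negbTE ->; rewrite scale0r.
Qed.

Lemma polar_diag m (A : ('I_m -> X) -> Y) u : multilinear A ->
  polar (fun u => A (fun=> u)) (fun _ : 'I_m => u) = m`!%:R *: A (fun=> u).
Proof.
by move=> Alin; rewrite polarE// sumr_const card_Sn scaler_nat.
Qed.

Lemma polar_multilinear m (A : ('I_m -> X) -> Y) : multilinear A ->
  multilinear (polar (m := m) (fun u => A (fun=> u))).
Proof.
move=> Alin i x a u v; rewrite !polarE// scaler_sumr -big_split /=.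
apply: eq_bigr => s _.
have dE w : (fun j => dfwith x i w (s j)) =
    dfwith (fun j => x (s j)) ((s^-1)%g i) w.
  apply/funext => j; have [->|ij] := eqVneq j ((s^-1)%g i).
    by rewrite permKV !dfwithin.
  rewrite !dfwithout//; first by rewrite eq_sym.
  by apply: contra_neq ij => ->; rewrite permK.
by rewrite !dE; exact: Alin.
Qed.

End multilinear_theory.

(** * Scalar convergence and continuity of polynomials *)

Lemma fmap_ultra T U (F : set_system T) (f : T -> U) :
  UltraFilter F -> UltraFilter (f @ F).
Proof.
move=> FU; split; first exact: fmap_proper_filter.
move=> G PG FG; rewrite eqEsubset; split=> // A GA.
have [//|FnA] := in_ultra_setVsetC (f @^-1` A) FU.
have GnA : G (~` A) by exact: FG.
by have /filter_ex[x []] : G (A `&` ~` A) by exact: filterI.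
Qed.

Section scalar_convergence.
Context {R : realType} {k : scalar_kind}.
Local Notation K := (scalar_field R k).

Lemma lt_of_real (r s : R) : r < s -> of_real k r < of_real k s.
Proof. by case: k => //= ?; rewrite complex.ltcE /= eqxx. Qed.

Lemma rnormB_sym (V : normedZmodType K) (v w : V) : rnorm (v - w) = rnorm (w - v).
Proof. by rewrite /rnorm distrC. Qed.

Lemma rnormZ (V : normedModType K) (a : K) (v : V) :
  rnorm (a *: v) = rnorm a * rnorm v.
Proof. by rewrite /rnorm normrZ reM im_ge0// mul0r subr0. Qed.

Lemma rnorm_of_real (r : R) : 0 <= r -> rnorm (of_real k r) = r.
Proof.
move=> r0; rewrite /rnorm ger0_norm ?of_realK//.
by rewrite (_ : 0 = of_real k 0) ?le_of_real//; case: k.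
Qed.

Lemma rnorm_eq0 (V : normedModType K) (v : V) : rnorm v = 0 -> v = 0.
Proof. by move=> v0; apply: normr0_eq0; rewrite -of_real_rnorm v0; case: k. Qed.

Lemma rnormN_zmod (V : normedZmodType K) (v : V) : rnorm (- v) = rnorm v.
Proof. by rewrite /rnorm normrN. Qed.

Lemma rnorm_zero (V : normedZmodType K) : rnorm (0 : V) = 0.
Proof. by rewrite /rnorm normr0 re0. Qed.

Lemma rnorm_one : rnorm (1 : K) = 1.
Proof. by rewrite /rnorm normr1; case: k. Qed.

Lemma rnorm_sum (V : normedZmodType K) I (r : seq I) (P : pred I) (F : I -> V) :
  rnorm (\sum_(i <- r | P i) F i) <= \sum_(i <- r | P i) rnorm (F i).
Proof.
elim/big_rec2 : _ => [|i x y _ xy]; first by rewrite rnorm_zero.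
by apply: le_trans (rnormD _ _) _; rewrite lerD2l.
Qed.

Lemma rnorm_prod I (r : seq I) (P : pred I) (F : I -> K) :
  rnorm (\prod_(i <- r | P i) F i) = \prod_(i <- r | P i) rnorm (F i).
Proof.
by apply: (big_morph (fun x : K => rnorm x)); [exact: rnormM|exact: rnorm_one].
Qed.

Lemma rnormX (x : K) n : rnorm (x ^+ n) = rnorm x ^+ n.
Proof. by elim: n => [|n IHn]; rewrite ?rnorm_one// !exprS rnormM IHn. Qed.

Lemma rnorm_le_re_im (x : K) : rnorm x <= `|re x| + `|im x|.
Proof.
rewrite rnormE -[leRHS]ger0_norm ?addr_ge0// -sqrtr_sqr ler_wsqrtr//.
rewrite sqrrD !real_normK ?num_real// -addrA lerD2l lerDr.
by rewrite mulrn_wge0// mulr_ge0.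
Qed.

Lemma cvg_rnormP (V : normedModType K) T (F : set_system T) {FF : Filter F}
    (f : T -> V) (l : V) :
  f @ F --> l <-> forall e : R, 0 < e -> \forall x \near F, rnorm (l - f x) < e.
Proof.
split=> [/cvgrPdist_lt fl e e0|fl].
  have := fl _ (of_real_gt0 k e0); apply: filterS => x /lt_re.
  by rewrite of_realK.
apply/cvgrPdist_lt => e e0; have := fl (re e).
rewrite -(re0 R k) => /(_ (lt_re e0)); apply: filterS => x lfx.
by rewrite -of_real_rnorm -(of_real_re (ltW e0)); exact: lt_of_real.
Qed.

Lemma cvg_rnorm (V : normedModType K) T (F : set_system T) {FF : Filter F}
    (f : T -> V) (l : V) (e : R) : f @ F --> l -> 0 < e ->
  \forall x \near F, rnorm (l - f x) < e.
Proof. by move=> /cvg_rnormP; apply. Qed.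

Lemma cvg_of_re_im T (F : set_system T) {FF : Filter F} (f : T -> K) (a b : R) :
  (fun x => re (f x)) @ F --> a -> (fun x => im (f x)) @ F --> b ->
  exists l : K, ProperFilter F -> f @ F --> (l : K^o).
Proof.
move=> fa fb.
have [l lP] : exists l : K, ProperFilter F -> re l = a /\ im l = b.
  case: k f fa fb => [f fa fb|f _ _]; last by exists (complex.Complex a b).
  exists a => PF; split=> //.
  by apply: (cvg_unique _ (cvg_cst 0) fb).
exists l => PF; have [la lb] := lP PF.
apply/(@cvg_rnormP K^o) => e e0.
have e20 : 0 < e / 2 by rewrite divr_gt0.
move/cvgrPdist_lt : fa => /(_ _ e20); move/cvgrPdist_lt : fb => /(_ _ e20).
apply: filterS2 => x; rewrite -la -lb => fx1 fx2.
apply: le_lt_trans (rnorm_le_re_im _) _.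
by rewrite reD reN imD imN (splitr e) addrC ltrD.
Qed.

(** Bounded scalar functions converge along every ultrafilter. *)
Lemma ultra_cvg T (F : set_system T) (FF : UltraFilter F) (f : T -> K) (M : R) :
  (forall x, rnorm (f x) <= M) -> exists l : K, f @ F --> (l : K^o).
Proof.
move=> fM.
have real_cvg (g : T -> R) : (forall x, `|g x| <= M) -> exists a : R, g @ F --> a.
  move=> gM; have := @segment_compact R (- M) M.
  rewrite compact_ultra => /(_ (g @ F) (fmap_ultra g FF)) [].
    by apply: (@filterE _ F) => x; rewrite /= in_itv /= -ler_norml.
  by move=> a [_ ga]; exists a.
have [a fa] := real_cvg _ (fun x => le_trans (abs_re _) (fM x)).
have [b fb] := real_cvg _ (fun x => le_trans (abs_im _) (fM x)).
by have [l /(_ _) fl] := cvg_of_re_im fa fb; exists l; exact: fl.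
Qed.

Lemma scalar_cauchy_cvg (u : nat -> K) :
  (forall e : R, 0 < e -> exists N, forall i j, (N <= i)%N -> (N <= j)%N ->
     rnorm (u i - u j) < e) -> exists l : K, u @ \oo --> (l : K^o).
Proof.
move=> cu.
have real_cvg (v : nat -> R) : (forall i j, `|v i - v j| <= rnorm (u i - u j)) ->
    exists a : R, v @ \oo --> a.
  move=> vu; have : cvg (v @ \oo).
    apply: cauchy_cvg; apply: cauchy_exP => e e0; have [N uN] := cu _ e0.
    exists (v N); exists N => // j /= Nj.
    by apply: le_lt_trans (vu _ _) _; exact: uN.
  by move=> va; exists (lim (v @ \oo)).
have [a fa] : exists a : R, (fun n => re (u n)) @ \oo --> a.
  by apply: real_cvg => i j; rewrite -reN -reD; exact: abs_re.
have [b fb] : exists b : R, (fun n => im (u n)) @ \oo --> b.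
  by apply: real_cvg => i j; rewrite -imN -imD; exact: abs_im.
by have [l /(_ _) fl] := cvg_of_re_im fa fb; exists l; exact: fl.
Qed.

End scalar_convergence.

Section homogeneous.
Context {R : realType} {k : scalar_kind}.
Local Notation K := (scalar_field R k).
Context {X : normedModType K}.

Section diagonal.
Context {m : nat} {A : ('I_m -> X) -> K^o} (Alin : multilinear A).

Lemma diagZ (a : K) u : A (fun=> a *: u) = a ^+ m *: A (fun=> u).
Proof.
rewrite (multilinear_scale (fun=> a))// prodr_const card_ord.
by [].
Qed.

(** A bound on the unit ball extends by homogeneity. *)
Lemma diag_bound : (0 < m)%N -> (forall u, rnorm u <= 1 -> rnorm (A (fun=> u)) <= 1) ->
  forall u, rnorm (A (fun=> u)) <= rnorm u ^+ m.
Proof.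
move=> m0 A1 u; have [u0|u0] := eqVneq (rnorm u) 0.
  have -> : u = (0 : K) *: u by rewrite scale0r (rnorm_eq0 u0).
  by rewrite diagZ expr0n gtn_eqF// scale0r rnorm_zero exprn_ge0// rnorm_ge0.
have u_gt0 : 0 < rnorm u by rewrite lt_neqAle eq_sym u0 rnorm_ge0.
pose v := of_real k (rnorm u)^-1 *: u.
have v1 : rnorm v = 1.
  by rewrite rnormZ rnorm_of_real ?invr_ge0 ?rnorm_ge0// mulVf.
have uv : u = of_real k (rnorm u) *: v.
  by rewrite scalerA -of_realM mulfV// -[LHS]scale1r; congr (_ *: _); case: k.
rewrite [X in A (fun=> X)]uv diagZ rnormZ /=.
rewrite (rnormX (of_real k (rnorm u))) rnorm_of_real ?rnorm_ge0//.
by rewrite ler_piMr ?exprn_ge0 ?rnorm_ge0//; apply: A1; rewrite v1.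
Qed.

End diagonal.

Lemma rnorm_sign n (s : {ffun 'I_n -> bool}) :
  rnorm (\prod_j (if s j then 1 else -1) : K) = 1.
Proof.
by rewrite rnorm_prod big1// => j _; case: ifP; rewrite ?rnormN rnorm_one.
Qed.

Lemma polar_bound m (q : X -> K^o) (x : 'I_m -> X) (rho : R) :
  (forall u, rnorm (q u) <= rnorm u ^+ m) -> (forall i, rnorm (x i) <= rho) ->
  rnorm (polar q x) <= (2 ^ m)%:R * (rho *+ m) ^+ m.
Proof.
move=> qm xrho; apply: le_trans (rnorm_sum _ _ _) _.
have -> : (2 ^ m)%N = #|{: {ffun 'I_m -> bool}}|.
  by rewrite card_ffun card_bool card_ord.
rewrite mulr_natl -sumr_const; apply: ler_sum => s _.
rewrite rnormZ rnorm_sign mul1r; apply: le_trans (qm _) _.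
apply: lerXn2r; rewrite ?nnegrE ?rnorm_ge0//.
  case: m x xrho s {qm} => [|m] x xrho s; first by rewrite mulr0n.
  by rewrite mulrn_wge0// (le_trans (rnorm_ge0 (x ord0))).
apply: le_trans (rnorm_sum _ _ _) _.
rewrite -[in leRHS](card_ord m) -sumr_const; apply: ler_sum => i _.
rewrite rnormZ; case: (s i); rewrite ?rnorm_one ?mul1r//= rnorm_zero mul0r.
exact: le_trans (rnorm_ge0 _) (xrho i).
Qed.

(** A homogeneous polynomial that is bounded on the unit ball is continuous. *)
Lemma diag_continuous m (A : ('I_m -> X) -> K^o) : multilinear A ->
  (forall u, rnorm (A (fun=> u)) <= rnorm u ^+ m) ->
  continuous (fun u => A (fun=> u)).
Proof.
move=> Alin Am x.
pose B := fun z : 'I_m -> X => (m`!%:R)^-1 *: polar (fun u => A (fun=> u)) z : K^o.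
have fact0 : m`!%:R != 0 :> K by rewrite pnatr_eq0 -lt0n fact_gt0.
have BE u : A (fun=> u) = B (fun=> u).
  by rewrite /B polar_diag// scalerA mulVf// scale1r.
have Blin : multilinear B.
  move=> i z a u v; rewrite /B (polar_multilinear Alin) scalerDr !scalerA.
  by rewrite [_ * a]mulrC.
pose rho := Num.max (rnorm x) 1.
pose C := rnorm ((m`!%:R)^-1 : K) * ((2 ^ m)%:R * (rho *+ m) ^+ m).
have BC z : (forall i, rnorm (z i) <= rho) -> rnorm (B z) <= C.
  move=> zr; rewrite /B rnormZ ler_wpM2l ?rnorm_ge0//.
  exact: polar_bound.
have C0 : 0 <= C.
  by apply: le_trans (BC (fun=> x) _); rewrite ?rnorm_ge0// => i; rewrite /rho le_max lexx.
pose D := (2 ^ m)%:R * C.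
have D0 : 0 <= D by rewrite mulr_ge0.
have lip t w : 0 < t <= 1 -> rnorm w <= 1 ->
    rnorm (A (fun=> x) - A (fun=> of_real k t *: w + x)) <= t * D.
  move=> /andP[t0 t1] w1; rewrite !BE.
  pose c (b : bool) := if b then of_real k t else 1.
  pose z (b : bool) := if b then w else x.
  have -> : (fun=> of_real k t *: w + x) = (fun=> \sum_b c b *: z b) :> ('I_m -> X).
    by apply/funext => i; rewrite big_bool /= scale1r.
  rewrite multilinear_comb// (bigD1 [ffun=> false])//=.
  have -> : (fun i => z ([ffun=> false] i)) = (fun=> x) :> ('I_m -> X).
    by apply/funext => i; rewrite ffunE.
  rewrite big1 ?scale1r; last by move=> i _; rewrite ffunE.
  rewrite opprD addrA subrr sub0r rnormN_zmod.
  apply: le_trans (rnorm_sum _ _ _) _.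
  rewrite /D mulrCA mulr_natl.
  have -> : (2 ^ m)%N = #|{: {ffun 'I_m -> bool}}|.
    by rewrite card_ffun card_bool card_ord.
  rewrite -sumr_const [leRHS](bigD1 [ffun=> false])//=.
  rewrite -[leLHS]add0r; apply: lerD; first by rewrite mulr_ge0// ltW.
  apply: ler_sum => f f0; rewrite rnormZ ler_pM ?rnorm_ge0//; last first.
    apply: BC => i; rewrite /z /rho; case: (f i); rewrite le_max ?lexx//.
    by rewrite w1 orbT.
  have [i fi] : exists i, f i.
    apply/existsP; apply: contraR f0; rewrite negb_exists => /forallP f0.
    by apply/eqP/ffunP => i; rewrite ffunE; exact/negbTE/f0.
  rewrite rnorm_prod (bigD1 i)//= /c fi (rnorm_of_real (ltW t0)).
  rewrite ler_piMr ?(ltW t0)//; apply: prodr_ile1 => j _; rewrite rnorm_ge0 /=.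
  by case: (f j); rewrite ?rnorm_one// (rnorm_of_real (ltW t0)).
apply/(@cvg_rnormP _ _ K^o) => e e0.
pose t := Num.min 1 (e / (D + 1)).
have t0 : 0 < t by rewrite lt_min ltr01 divr_gt0// ltr_wpDl.
have FF := nbhs_filter x.
have := @cvg_rnorm _ _ X _ (nbhs x) FF id x t (@cvg_id _ (nbhs x)) t0.
apply: filterS => y xy.
have -> : y = of_real k t *: (of_real k t^-1 *: (y - x)) + x.
  rewrite scalerA -of_realM mulfV ?gt_eqF//.
  rewrite -[LHS](subrK x); congr (_ + _); rewrite -[LHS]scale1r.
  by congr (_ *: _); case: k.
apply: le_lt_trans (lip _ _ _ _) _.
- by rewrite t0 /t ge_min lexx.
- have ti0 : 0 <= t^-1 by rewrite invr_ge0 ltW.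
  rewrite rnormZ (rnorm_of_real ti0) mulrC ler_pdivrMr// mul1r.
  by rewrite rnormB_sym ltW.
apply: le_lt_trans (_ : e / (D + 1) * D < _).
  by rewrite ler_wpM2r// /t ge_min lexx orbT.
rewrite mulrAC ltr_pdivrMr ?ltr_wpDl// ltr_pM2l//.
by rewrite ltrDl.
Qed.

End homogeneous.

(** * Compactness of the ball of polynomials *)

Lemma cvg_initial_topology (S : choiceType) (T : topologicalType) (f : S -> T)
    (F : set_system S) (s : S) : Filter F ->
  f @ F --> f s -> F --> (s : initial_topology f).
Proof.
move=> FF fF A /= [_ [[B oB <-] Bfs sBA]].
have /fF FB : nbhs (f s) B by exact: open_nbhs_nbhs.
exact: filterS sBA FB.
Qed.

Section weak_star_ball_topology.
Context {R : realType} {k : scalar_kind}.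
Local Notation K := (scalar_field R k).
Context {m : nat} {X : normedModType K}.
Hypothesis m_gt0 : (0 < m)%N.
Implicit Types (q : X -> K^o) (s : tensor_rep X) (z : completed_tensor m X).

Lemma poly_ball_le q x : poly_ball m X q -> rnorm (q x) <= rnorm x ^+ m.
Proof.
move=> [[_ [A [Alin qA]]] q1]; rewrite qA.
apply: (diag_bound Alin) => // u u1; rewrite -qA -lee_fin.
by apply: le_trans q1; apply: ereal_sup_ubound; exists u.
Qed.

Lemma poly_ball_polar q : poly_ball m X q ->
  multilinear (polar (m := m) q) /\
  forall x, polar q (fun _ : 'I_m => x) = m`!%:R *: q x.
Proof.
move=> [[_ [A [Alin qA]]] _]; have -> : q = (fun u => A (fun=> u)) by exact/funext.
by split=> [|x]; [exact: polar_multilinear|exact: polar_diag].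
Qed.

(** Membership in the ball, in terms of pointwise conditions that are stable
    under pointwise limits. *)
Lemma in_poly_ball q : (forall x, rnorm (q x) <= rnorm x ^+ m) ->
  multilinear (polar (m := m) q) ->
  (forall x, polar q (fun _ : 'I_m => x) = m`!%:R *: q x) -> poly_ball m X q.
Proof.
move=> qm pq pqx.
have fact0 : m`!%:R != 0 :> K by rewrite pnatr_eq0 -lt0n fact_gt0.
pose A (x : 'I_m -> X) : K^o := (m`!%:R)^-1 *: polar q x.
have qA x : q x = A (fun=> x) by rewrite /A pqx scalerA mulVf// scale1r.
have Alin : multilinear A.
  move=> i x a u v; rewrite /A pq scalerDr !scalerA.
  by rewrite [_ * a]mulrC.
split; first split.
- rewrite (funext qA); apply: diag_continuous => // u.
  by rewrite -qA.
- by exists A.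
apply: ge_ereal_sup => _ [x /= x1 <-]; rewrite lee_fin.
by apply: le_trans (qm x) _; rewrite exprn_ile1// rnorm_ge0.
Qed.

(** The pairing of the symmetric tensor represented by [s] with [q]. *)
Definition tensor_eval s q : K := \sum_(a <- s) a.1 * q a.2.

Lemma tensor_eval_sub s t q :
  tensor_eval (tensor_sub s t) q = tensor_eval s q - tensor_eval t q.
Proof.
rewrite /tensor_eval /tensor_sub big_cat big_map /=; congr (_ + _).
by rewrite -sumrN; apply: eq_bigr => a _; rewrite mulNr.
Qed.

Lemma tensor_eval_le q s : poly_ball m X q -> rnorm (tensor_eval s q) <= proj_norm m s.
Proof.
move=> bq; have [[_ [A [Alin qA]]] _] := bq.
apply: lb_le_inf.
  by exists (\sum_(a <- s) rnorm a.1 * rnorm a.2 ^+ m), s.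
move=> _ [t st <-].
have -> : tensor_eval s q = tensor_eval t q.
  rewrite /tensor_eval; under eq_bigr do rewrite qA.
  by rewrite st//; under [RHS]eq_bigr do rewrite qA.
apply: le_trans (rnorm_sum _ _ _) _; apply: ler_sum => a _.
by rewrite rnormM ler_wpM2l ?rnorm_ge0// poly_ball_le.
Qed.

Lemma tensor_eval_cvg q z : poly_ball m X q ->
  (fun n => tensor_eval (z n) q) @ \oo --> (pairing q z : K^o).
Proof.
move=> bq; suff [l ul] : exists l : K, (fun n => tensor_eval (z n) q) @ \oo --> (l : K^o).
  by rewrite /pairing (_ : lim _ = l)//; apply: cvg_lim => //; exact: norm_hausdorff.
apply: scalar_cauchy_cvg => e e0; have [N zN] := approx_cauchy z e0.
exists N => i j Ni Nj; apply: le_lt_trans (zN _ _ Ni Nj).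
by rewrite -tensor_eval_sub tensor_eval_le.
Qed.

(** The values of a polynomial of the ball on the tensors approximating [z]
    converge uniformly over the ball. *)
Lemma pairing_approx z (e : R) : 0 < e -> exists n, forall q, poly_ball m X q ->
  rnorm (pairing q z - tensor_eval (z n) q) <= e.
Proof.
move=> e0; have e20 : 0 < e / 2 by rewrite divr_gt0.
have [N zN] := approx_cauchy z e20; exists N => q bq.
have := cvg_rnorm (tensor_eval_cvg (z := z) bq) e20.
move=> [M _ /(_ (maxn M N) (leq_maxl _ _)) /= zM].
rewrite -(subrK (tensor_eval (z (maxn M N)) q) (pairing q z)) -addrA.
apply: le_trans (rnormD _ _) _; rewrite (splitr e) lerD ?(ltW zM)//.
rewrite -tensor_eval_sub; apply: le_trans (tensor_eval_le _ bq) _.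
by apply/ltW/zN => //; exact: leq_maxr.
Qed.

Let cvg_uniq T (F : set_system T) {FF : ProperFilter F} (f : T -> K^o) (a b : K^o) :
  f @ F --> a -> f @ F --> b -> a = b.
Proof. by move=> fa fb; apply: (cvg_unique _ fa fb); exact: norm_hausdorff. Qed.

(** Banach-Alaoglu: along an ultrafilter the polynomials converge pointwise; the
    polarization formula shows that the limit is again a polynomial. *)
Lemma weak_star_ball_compact : compact [set: weak_star_ball m X].
Proof.
rewrite compact_ultra => F FU _.
have PF : ProperFilter F := @ultra_proper _ _ FU.
have FF : Filter F := @filter_filter _ _ PF.
have ball (q : weak_star_ball m X) : poly_ball m X (val (q : unit_ball m X)).
  by have := valP (q : unit_ball m X); rewrite inE.
pose ev x (q : weak_star_ball m X) : K^o := val (q : unit_ball m X) x.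
have /choice[q0 evq0] x : exists l : K, ev x @ F --> (l : K^o).
  apply: (@ultra_cvg _ _ _ _ _ _ (rnorm x ^+ m)) => q.
  exact: poly_ball_le.
have q0m x : rnorm (q0 x) <= rnorm x ^+ m.
  apply/ler_addgt0Pr => e e0.
  have := cvg_rnorm (FF := FF) (evq0 x) e0.
  move=> /filter_ex[q qx]; rewrite -(subrK (ev x q) (q0 x)).
  apply: le_trans (rnormD _ _) _; rewrite addrC lerD ?(ltW qx)//.
  exact: poly_ball_le.
have polar_cvg (x : 'I_m -> X) :
    (fun q : weak_star_ball m X => polar (val (q : unit_ball m X)) x : K^o) @ F -->
    (polar q0 x : K^o).
  rewrite /polar; apply: cvg_big => [|s _]; first exact: add_continuous.
  apply: cvgZr; exact: evq0.
have bq0 : poly_ball m X q0.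
  apply: in_poly_ball => //.
    move=> i x a u v; apply: cvg_uniq (polar_cvg _) _.
    have -> : (fun q : weak_star_ball m X =>
          polar (val (q : unit_ball m X)) (dfwith x i (a *: u + v)) : K^o) =
        (fun q : weak_star_ball m X =>
          a *: (polar (val (q : unit_ball m X)) (dfwith x i u) : K^o) +
          polar (val (q : unit_ball m X)) (dfwith x i v)).
      by apply/funext => q; have [-> _] := poly_ball_polar (ball q).
    by apply: cvgD; [apply: cvgZr; exact: polar_cvg|exact: polar_cvg].
  move=> x; apply: cvg_uniq (polar_cvg _) _.
  have -> : (fun q : weak_star_ball m X =>
        polar (val (q : unit_ball m X)) (fun _ : 'I_m => x) : K^o) =
      (fun q : weak_star_ball m X => m`!%:R *: (ev x q : K^o)).
    by apply/funext => q; have [_ ->] := poly_ball_polar (ball q).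
  by apply: cvgZr; exact: evq0.
pose p0 : weak_star_ball m X := SigSub (mem_set bq0).
exists p0; split=> //=.
apply: cvg_initial_topology; apply/cvg_sup => z.
apply: cvg_initial_topology.
apply/(@cvg_rnormP _ _ K^o) => e e0.
have e40 : 0 < e / 4 by rewrite divr_gt0.
have [n zn] := pairing_approx z e40.
have : (fun q : weak_star_ball m X =>
      tensor_eval (z n) (val (q : unit_ball m X)) : K^o) @ F -->
    (tensor_eval (z n) q0 : K^o).
  rewrite /tensor_eval; apply: cvg_big => [|a _]; first exact: add_continuous.
  by apply: (@cvgZr _ K^o); exact: evq0.
move=> /(cvg_rnorm (FF := FF) (V := K^o)) /(_ e40); apply: filterS => q qz.
have h1 := zn _ bq0; have h2 := zn _ (ball q); rewrite rnormB_sym in h2.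
rewrite /= /proj.
have -> : pairing q0 z - pairing (val (q : unit_ball m X)) z =
  (pairing q0 z - tensor_eval (z n) q0) +
  (tensor_eval (z n) q0 - tensor_eval (z n) (val (q : unit_ball m X))) +
  (tensor_eval (z n) (val (q : unit_ball m X)) - pairing (val (q : unit_ball m X)) z).
  by rewrite !subrKA.
apply: le_lt_trans (rnormD _ _) _.
apply: (@le_lt_trans _ _ (e / 4 + e / 4 + e / 4)); last by lra.
apply: lerD => //; apply: le_trans (rnormD _ _) _.
by rewrite lerD// ltW.
Qed.

(** The evaluations at points of [X] are continuous and separate polynomials. *)
Lemma weak_star_ball_hausdorff : hausdorff_space (weak_star_ball m X).
Proof.
move=> p q pq; apply: val_inj; apply/funext => x.
apply: (@norm_hausdorff K K^o).
move=> A B pA qB.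
have /(_ _ pA) pA' := @continuous_delta R k m X x p.
have /(_ _ qB) qB' := @continuous_delta R k m X x q.
by have [r [Ar Br]] := pq _ _ pA' qB'; exists (val (r : unit_ball m X) x).
Qed.

End weak_star_ball_topology.

(** * Extension of bounded operators *)

Section normed_module_lemmas.
Context {R : realType} {k : scalar_kind}.
Local Notation K := (scalar_field R k).

Lemma nbhs_rnormP (E : normedModType K) (u : E) (A : set E) :
  nbhs u A <-> exists2 e : R, 0 < e & forall v, rnorm (u - v) < e -> A v.
Proof.
split=> [/nbhs_normP[e /= e0 eA]|[e e0 eA]].
  exists (re e); first by rewrite -(re0 R k); exact: lt_re.
  move=> v uv; apply: eA; rewrite /ball_ /= -of_real_rnorm -(of_real_re (ltW e0)).
  exact: lt_of_real.
apply/nbhs_normP; exists (of_real k e); first exact: of_real_gt0.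
by move=> v /lt_re; rewrite of_realK => /eA.
Qed.

Lemma closure_rnormP (E : normedModType K) (A : set E) u :
  closure A u <-> forall e : R, 0 < e -> exists2 v, A v & rnorm (u - v) < e.
Proof.
split=> [Au e e0|Au B /nbhs_rnormP[e e0 eB]].
  have /Au[v [Av uv]] : nbhs u [set v | rnorm (u - v) < e].
    by apply/nbhs_rnormP; exists e.
  by exists v.
by have [v Av uv] := Au _ e0; exists v; split=> //; exact: eB.
Qed.

Lemma rnorm_le_eps0 (E : normedModType K) (v : E) (C : R) : 0 <= C ->
  (forall e, 0 < e -> rnorm v <= C * e) -> v = 0.
Proof.
move=> C0 vC; apply: rnorm_eq0; apply/eqP; rewrite eq_le rnorm_ge0 andbT.
apply/ler_addgt0Pr => e e0; rewrite add0r.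
have C1 : 0 < C + 1 by rewrite ltr_wpDl.
apply: le_trans (vC (e / (C + 1)) _) _; first by rewrite divr_gt0.
by rewrite mulrA ler_pdivrMr// mulrC ler_wpM2l ?ltW// ltrDl.
Qed.

Lemma complete_rnorm_cvg (Y : completeNormedModType K) (u : nat -> Y) :
  (forall e : R, 0 < e -> exists N, forall i j, (N <= i)%N -> (N <= j)%N ->
     rnorm (u i - u j) < e) -> exists l : Y, u @ \oo --> l.
Proof.
move=> cu; suff : cvg (u @ \oo) by move=> ul; exists (lim (u @ \oo)).
apply/cauchy_cvgP; apply: cauchy_exP => e e0.
have re_e0 : 0 < re e by rewrite -(re0 R k); exact: lt_re.
have [N uN] := cu _ re_e0; exists (u N); exists N => // j /= Nj.
rewrite -ball_normE /ball_ /= -of_real_rnorm -(of_real_re (ltW e0)).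
by apply: lt_of_real; exact: uN.
Qed.

(** A bounded operator defined on a dense subspace of a closed subspace extends
    to it. The subspace is the range of [J], and the operator maps [J i] to
    [T i]. *)
Lemma extend_by_density (E : normedModType K) (Y : completeNormedModType K)
    (I : Type) (J : I -> E) (T : I -> Y) (C : R) (i0 : I) : 0 <= C ->
  J i0 = 0 ->
  (forall a i j, exists l, J l = a *: J i + J j /\ T l = a *: T i + T j) ->
  (forall i, rnorm (T i) <= C * rnorm (J i)) ->
  let G := closure (range J) in
  exists v : E -> Y, [/\ closed G, submod_closed (mem G),
    forall a, {in G &, forall x y, v (a *: x + y) = a *: v x + v y},
    {within G, continuous v} & forall i, v (J i) = T i].
Proof.
move=> C0 Ji0 comb TC G.
have TB i j : rnorm (T i - T j) <= C * rnorm (J i - J j).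
  have [l [Jl Tl]] := comb (-1) j i.
  have := TC l; rewrite Jl Tl !scaleN1r.
  by rewrite [- T j + _]addrC [- J j + _]addrC.
have GJ i : G (J i) by apply: subset_closure; exists i.
have Gapprox u e : G u -> 0 < e -> exists i, rnorm (u - J i) < e.
  by move=> /closure_rnormP Gu /Gu[_ [i _ <-]]; exists i.
have inv_gt0 n : 0 < n.+1%:R^-1 :> R by rewrite invr_gt0 ltr0n.
(* The value at [u] is characterized by its distance to the values [T i]. *)
have /choice[v vP] (u : E) :
    exists y : Y, G u -> forall i, rnorm (y - T i) <= C * rnorm (u - J i).
  have [Gu|nGu] := pselect (G u); last by exists 0.
  have /choice[s su] n : exists i, rnorm (u - J i) < n.+1%:R^-1 :=
    Gapprox _ _ Gu (inv_gt0 n).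
  have small (e : R) : 0 < e -> exists N, forall n, (N <= n)%N -> rnorm (u - J (s n)) < e.
    move=> e0; exists (Num.trunc e^-1) => n Nn; apply: lt_trans (su n) _.
    rewrite invf_plt ?posrE// ?ltr0n//.
    by apply: lt_le_trans (truncnS_gt _) _; rewrite ler_nat ltnS.
  have [y sy] : exists y : Y, T \o s @ \oo --> y.
    apply: complete_rnorm_cvg => e e0.
    have d0 : 0 < e / (C + 1) / 2 by rewrite !divr_gt0// ltr_wpDl.
    have [N sN] := small _ d0; exists N => i j Ni Nj.
    have hi := ltW (sN _ Ni); have hj := ltW (sN _ Nj); rewrite rnormB_sym in hi.
    apply: le_lt_trans (TB _ _) _; rewrite -(subrKA u).
    apply: le_lt_trans (ler_wpM2l C0 (rnormD _ _)) _.
    apply: le_lt_trans (ler_wpM2l C0 (lerD hi hj)) _.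
    by rewrite -splitr mulrA ltr_pdivrMr ?ltr_wpDl// mulrC ltr_pM2l// ltrDl.
  exists y => _ i; apply/ler_addgt0Pr => e e0.
  have d0 : 0 < e / 2 by rewrite divr_gt0.
  have d'0 : 0 < e / 2 / (C + 1) by rewrite divr_gt0// ltr_wpDl.
  have [N sN] := small _ d'0.
  have [M _ sM] := cvg_rnorm sy d0.
  pose n := maxn M N.
  have := sM n (leq_maxl _ _); have := sN n (leq_maxr _ _) => /= /ltW un /ltW yn.
  rewrite -(subrKA (T (s n))); apply: le_trans (rnormD _ _) _.
  have h : rnorm (T (s n) - T i) <= C * (e / 2 / (C + 1) + rnorm (u - J i)).
    apply: le_trans (TB _ _) _; rewrite ler_wpM2l// -(subrKA u).
    by apply: le_trans (rnormD _ _) _; rewrite lerD// rnormB_sym.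
  have hC : C * (e / 2 / (C + 1)) <= e / 2.
    by rewrite mulrA ler_pdivrMr ?ltr_wpDl// mulrC ler_wpM2l ?ltW// ltrDl.
  apply: le_trans (lerD yn h) _; rewrite mulrDr.
  by move: hC; set c := C * (e / 2 / _); set r := C * rnorm _; lra.
have vJ i : v (J i) = T i.
  apply/eqP; rewrite -subr_eq0; apply/eqP/rnorm_eq0/eqP.
  rewrite eq_le rnorm_ge0 andbT; apply: le_trans (vP _ (GJ i) i) _.
  by rewrite subrr rnorm_zero mulr0.
have Glin a x y : G x -> G y -> G (a *: x + y).
  move=> Gx Gy; apply/closure_rnormP => e e0.
  have a1 : 0 < rnorm a + 1 by rewrite ltr_wpDl// rnorm_ge0.
  have d0 : 0 < e / (rnorm a + 1) by rewrite divr_gt0.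
  have [i xi] := Gapprox _ _ Gx d0; have [j yj] := Gapprox _ _ Gy d0.
  have [l [Jl _]] := comb a i j; exists (J l); first by exists l.
  rewrite Jl opprD addrACA -scalerBr; apply: le_lt_trans (rnormD _ _) _.
  rewrite rnormZ.
  apply: (@le_lt_trans _ _ (rnorm a * (e / (rnorm a + 1)) + rnorm (y - J j))).
    by rewrite lerD2r ler_wpM2l ?rnorm_ge0// ltW.
  rewrite -ltrBrDl; apply: lt_le_trans yj _.
  rewrite lerBrDl -[X in _ + X]mul1r -mulrDl mulrC divfK//.
  by rewrite gt_eqF.
have vlin a x y : G x -> G y -> v (a *: x + y) = a *: v x + v y.
  move=> Gx Gy; apply/eqP; rewrite -subr_eq0; apply/eqP.
  apply: (@rnorm_le_eps0 _ _ (C * (rnorm a + 1) *+ 2)).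
    by rewrite mulrn_wge0// mulr_ge0// addr_ge0// rnorm_ge0.
  move=> e e0; have [i xi] := Gapprox _ _ Gx e0; have [j yj] := Gapprox _ _ Gy e0.
  have [l [Jl Tl]] := comb a i j.
  rewrite -(subrKA (T l)); apply: le_trans (rnormD _ _) _.
  rewrite mulr2n mulrDl lerD//.
    apply: le_trans (vP _ (Glin a _ _ Gx Gy) l) _; rewrite -mulrA ler_wpM2l//.
    rewrite Jl opprD addrACA -scalerBr; apply: le_trans (rnormD _ _) _.
    by rewrite mulrDl mul1r rnormZ lerD// ?ler_wpM2l ?rnorm_ge0// ltW.
  rewrite Tl opprD addrACA -scalerBr; apply: le_trans (rnormD _ _) _.
  have hx : rnorm (T i - v x) <= C * e.
    by rewrite rnormB_sym; apply: le_trans (vP _ Gx _) _; rewrite ler_wpM2l// ltW.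
  have hy : rnorm (T j - v y) <= C * e.
    by rewrite rnormB_sym; apply: le_trans (vP _ Gy _) _; rewrite ler_wpM2l// ltW.
  rewrite rnormZ; apply: le_trans (lerD (ler_wpM2l (rnorm_ge0 a) hx) hy) _.
  by rewrite le_eqVlt; apply/orP; left; apply/eqP; ring.
exists v; split=> //.
- exact: closed_closure.
- split; first by rewrite inE -Ji0.
  by move=> a x y; rewrite !inE => Gx Gy; exact: Glin.
- by move=> a x y; rewrite !inE; exact: vlin.
apply/subspace_continuousP => u Gu; apply/cvg_rnormP => e e0.
have C1 : 0 < C + 1 by rewrite ltr_wpDl.
apply/nbhs_rnormP; exists (e / (C + 1)); first by rewrite divr_gt0.
move=> w uw Gw /=.
apply: (@le_lt_trans _ _ (C * rnorm (u - w))); last first.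
  apply: (@le_lt_trans _ _ (C * (e / (C + 1)))); first by rewrite ler_wpM2l// ltW.
  by rewrite mulrA ltr_pdivrMr// mulrC ltr_pM2l// ltrDl.
apply/ler_addgt0Pr => d d0.
have d'0 : 0 < d / (C + 1) / 2 by rewrite !divr_gt0.
have [i ui] := Gapprox _ _ Gu d'0.
rewrite -(subrKA (T i)); apply: le_trans (rnormD _ _) _.
apply: le_trans (lerD (vP _ Gu i) (_ : _ <= C * rnorm (w - J i))) _.
  by rewrite rnormB_sym vP.
have h : rnorm (w - J i) <= rnorm (u - w) + d / (C + 1) / 2.
  rewrite -(subrKA u); apply: le_trans (rnormD _ _) _.
  by rewrite rnormB_sym lerD2l ltW.
have hC : C * (d / (C + 1) / 2) <= d / 2.
  rewrite -mulrA [_^-1 * _]mulrC mulrA mulrA ler_pdivrMr// [d / 2 * _]mulrC.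
  by rewrite -mulrA ler_wpM2r ?divr_ge0 ?ltW// ltrDl.
apply: le_trans (lerD (ler_wpM2l C0 (ltW ui)) (ler_wpM2l C0 h)) _.
by rewrite mulrDr; move: hC; set c := C * (d / _ / 2); set r := C * rnorm _; lra.
Qed.

End normed_module_lemmas.

(** * Tensors as elements of L_p *)

Section power_mean.
Context {R : realType}.
Variables (p : R) (p1 : 1 <= p).

Lemma powRVK (x : R) : 0 <= x -> (x `^ p^-1) `^ p = x.
Proof. by move=> x0; rewrite -powRrM mulVf ?powRr1// gt_eqF// (lt_le_trans _ p1). Qed.

Lemma powRKV (x : R) : 0 <= x -> (x `^ p) `^ p^-1 = x.
Proof. by move=> x0; rewrite -powRrM mulfV ?powRr1// gt_eqF// (lt_le_trans _ p1). Qed.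

Lemma le_powR (x y : R) : 0 <= x -> x <= y -> x `^ p <= y `^ p.
Proof.
move=> x0 xy; have p0 : 0 < p by exact: lt_le_trans p1.
by rewrite ge0_ler_powR ?nnegrE ?(ltW p0)// (le_trans x0).
Qed.

Lemma le_powRV (x y : R) : 0 <= x -> x <= y -> x `^ p^-1 <= y `^ p^-1.
Proof.
move=> x0 xy; have p0 : 0 < p by exact: lt_le_trans p1.
by rewrite ge0_ler_powR ?nnegrE ?invr_ge0 ?(ltW p0)// (le_trans x0).
Qed.

Lemma le_of_powR (C x y : R) : 0 <= C -> 0 <= x -> 0 <= y ->
  x `^ p <= C `^ p * y `^ p -> x <= C * y.
Proof.
move=> C0 x0 y0; rewrite -powRM// => xy.
rewrite -(powRKV x0) -(powRKV (mulr_ge0 C0 y0)).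
by apply: le_powRV xy; exact: powR_ge0.
Qed.

(** The real power is not continuous at [0] from the left, where it takes the
    value [1]: hence the restriction to nonnegative functions. *)
Lemma continuous_powR (T : topologicalType) (f : T -> R) : continuous f ->
  (forall x, 0 <= f x) -> continuous (fun x => f x `^ p).
Proof.
move=> cf f0 x; have p0 : 0 < p by exact: lt_le_trans p1.
have [fx0|fx0] := ltP 0 (f x).
  apply: (@continuous_comp _ _ _ f (fun y : R => y `^ p)); first exact: cf.
  apply/differentiable_continuous/derivable1_diffP.
  by apply: derivable_powR; rewrite in_itv /= fx0.
have {}fx0 : f x = 0 by apply/eqP; rewrite eq_le fx0 f0.
have FF := nbhs_filter x; apply/cvgrPdist_lt => e e0; rewrite fx0 powR0 ?gt_eqF//.
have d0 : 0 < Num.min 1 e by rewrite lt_min ltr01.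
have /cvgrPdist_lt /(_ _ d0) := cf x; rewrite fx0; apply: filterS => y.
rewrite !sub0r !normrN !ger0_norm ?powR_ge0// lt_min => /andP[fy1 fye].
apply: le_lt_trans fye; have [->|fy0] := eqVneq (f y) 0.
  by rewrite powR0// gt_eqF.
rewrite -[leRHS]powRr1//; apply: ger_powR => //.
by rewrite lt_neqAle eq_sym fy0 f0 ltW.
Qed.

End power_mean.

Section tensor_map.
Context {R : realType} {k : scalar_kind} {X : normedModType (scalar_field R k)}.
Local Notation K := (scalar_field R k).

(** The value on the tensor represented by [s] of the linear map that extends
    [f]; it may depend on the representation. *)
Definition tensor_map (V : lmodType K) (f : X -> V) (s : tensor_rep X) : V :=
  \sum_(a <- s) a.1 *: f a.2.

Lemma tensor_map_nil (V : lmodType K) (f : X -> V) : tensor_map f [::] = 0.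
Proof. by rewrite /tensor_map big_nil. Qed.

Lemma tensor_map_cons (V : lmodType K) (f : X -> V) a s :
  tensor_map f (a :: s) = a.1 *: f a.2 + tensor_map f s.
Proof. by rewrite /tensor_map big_cons. Qed.

Lemma tensor_map1 (V : lmodType K) (f : X -> V) x : tensor_map f [:: (1, x)] = f x.
Proof. by rewrite /tensor_map big_seq1 scale1r. Qed.

Lemma tensor_map_comb (V : lmodType K) (f : X -> V) (a : K) s t :
  tensor_map f ([seq (a * b.1, b.2) | b <- s] ++ t) =
    a *: tensor_map f s + tensor_map f t.
Proof.
rewrite /tensor_map big_cat big_map scaler_sumr; congr (_ + _).
by apply: eq_bigr => b _; rewrite scalerA.
Qed.

(** A map that is linear on a subspace commutes with the linear extensions. *)
Lemma linear_tensor_map (V W : lmodType K) (G : set V) (v : V -> W) (f : X -> V) :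
  submod_closed (mem G) ->
  (forall a : K, {in G &, forall x y, v (a *: x + y) = a *: v x + v y}) ->
  (forall x, G (f x)) ->
  forall s, G (tensor_map f s) /\ v (tensor_map f s) = tensor_map (v \o f) s.
Proof.
move=> [G0 Glin] vlin Gf; rewrite inE in G0.
elim=> [|a s [Gs vs]].
  rewrite !tensor_map_nil; split=> //.
  have := vlin (-1) 0 0 (mem_set G0) (mem_set G0).
  by rewrite scaler0 addr0 scaleN1r addNr.
rewrite !tensor_map_cons; split.
  by have := Glin a.1 _ _ (mem_set (Gf a.2)) (mem_set Gs); rewrite inE.
by rewrite (vlin a.1 _ _ (mem_set (Gf a.2)) (mem_set Gs)) vs.
Qed.

End tensor_map.

Section Lp_tensor.
Context {R : realType} {k : scalar_kind}.
Local Notation K := (scalar_field R k).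
Context {p : R} {p1 : 1 <= p} {m : nat} {X : normedModType K}.
Hypothesis m_gt0 : (0 < m)%N.
Let B := weak_star_ball m X.
Variable mu : probability (borel B) R.
Local Open Scope quotient_scope.

(** The value of the tensor [s] at the point [q] of the ball. *)
Definition ball_eval (s : tensor_rep X) (q : B) : K^o :=
  tensor_eval s (val (q : unit_ball m X)).

Lemma ball_eval_cons a s q :
  ball_eval (a :: s) q = a.1 * (val (q : unit_ball m X)) a.2 + ball_eval s q.
Proof. by rewrite /ball_eval /tensor_eval big_cons. Qed.

Lemma ball_eval_continuous s : continuous (ball_eval s).
Proof.
elim: s => [|a s IHs].
  rewrite (_ : ball_eval [::] = cst 0); first exact: cst_continuous.
  by apply/funext => q; rewrite /ball_eval /tensor_eval big_nil.
rewrite (_ : ball_eval _ = fun q =>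
  a.1 *: ((val (q : unit_ball m X)) a.2 : K^o) + ball_eval s q); last first.
  by apply/funext => q; rewrite ball_eval_cons.
move=> q; apply: (@continuousD _ K^o B) => //; last exact: IHs.
apply: (@continuousZr _ K^o B); exact: (@continuous_delta R k m X a.2 q).
Qed.

(** The class of the tensor [s] in [L_p]. *)
Definition Lp_tensor (s : tensor_rep X) : Lp k mu p1 :=
  tensor_map (fun x => j_p mu p1 (delta m x)) s.

Let mu_fin : (mu setT < +oo)%E.
Proof. by rewrite probability_setT ltry. Qed.

(** The class of a tensor is represented by its evaluation function. *)
Lemma Lp_tensorE s : exists F : Lp_pre k mu p1,
  Lp_tensor s = \pi_(Lp k mu p1) F /\ (F : borel B -> K^o) = ball_eval s.
Proof.
elim: s => [|a s [F [sF Fs]]].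
  exists 0; split; first exact: tensor_map_nil.
  by apply/funext => q; rewrite /ball_eval /tensor_eval big_nil.
pose D := insubd (0 : Lp_pre k mu p1) (delta m a.2 : borel B -> K^o).
have DE : (D : borel B -> K^o) = (delta m a.2 : borel B -> K^o).
  rewrite /D insubdK//= /Lp_pred inE; apply: continuous_Lp_fun => //.
  exact: weak_star_ball_compact.
exists (a.1 *: D + F); split.
  rewrite /Lp_tensor tensor_map_cons -/(Lp_tensor s) sF.
  rewrite -[j_p _ _ _]/(\pi_(Lp k mu p1) D).
  rewrite -[_ *: _]/(Lp_scale _ _) Lp_scaleE.
  by rewrite -[_ + _]/(Lp_add _ _) Lp_addE.
apply/funext => q; rewrite ball_eval_cons -Fs.
by rewrite -[LHS]/(a.1 * (D q : K) + F q) DE.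
Qed.

Lemma ball_eval_rnorm_continuous s :
  continuous (fun q : B => rnorm (ball_eval s q) `^ p).
Proof.
apply: continuous_powR => [//|q|q]; last exact: rnorm_ge0.
apply: (@continuous_comp _ _ _ (ball_eval s) (fun x : K => rnorm x)).
  exact: ball_eval_continuous.
exact: continuous_rnorm.
Qed.

Lemma Lp_tensor_norm s :
  ((rnorm (Lp_tensor s) `^ p)%:E = \int[mu]_q (rnorm (ball_eval s q) `^ p)%:E)%E.
Proof.
have [F [-> Fs]] := Lp_tensorE s; have p0 : 0 < p by exact: lt_le_trans p1.
rewrite /rnorm -[`|_|]/(Lp_norm _) Lp_normE of_realK.
have [mF lF] := Lp_preP F.
have fin : Lp_seminorm mu p F \is a fin_num.
  by rewrite ge0_fin_numE// Lp_seminorm_ge0.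
rewrite -poweR_EFin fineK// /Lp_seminorm unlock /= Fs.
rewrite -poweRrM mulVf ?gt_eqF// poweRe1; last first.
  by apply: integral_ge0 => q _; rewrite lee_fin powR_ge0.
apply: eq_integral => q _ /=.
by rewrite ger0_norm// rnorm_ge0.
Qed.

End Lp_tensor.

(** * Factorable polynomials are summing *)

Section factorization.
Context {R : realType} {k : scalar_kind}.
Local Notation K := (scalar_field R k).

Lemma bounded_on_subspace (E Y : normedModType K) (G : set E) (v : E -> Y) :
  submod_closed (mem G) ->
  (forall a : K, {in G &, forall x y, v (a *: x + y) = a *: v x + v y}) ->
  {within G, continuous v} ->
  exists2 C : R, 0 < C & forall u, G u -> rnorm (v u) <= C * rnorm u.
Proof.
move=> [G0 Glin] vlin cv; rewrite inE in G0.
have v0 : v 0 = 0.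
  have := vlin (-1) 0 0 (mem_set G0) (mem_set G0).
  by rewrite scaler0 addr0 scaleN1r addNr.
have vZ a u : G u -> v (a *: u) = a *: v u.
  move=> Gu; have := vlin a u 0 (mem_set Gu) (mem_set G0).
  by rewrite v0 !addr0.
have GZ a u : G u -> G (a *: u).
  move=> Gu; have := Glin a u 0; rewrite addr0 !inE; exact.
move/subspace_continuousP : cv => /(_ _ G0) cv0.
have {}cv0 : v x @[x --> within G (nbhs (0 : E))] --> (0 : Y) by rewrite -v0.
have FF : Filter (within G (nbhs (0 : E))) by exact: within_filter.
have := @cvg_rnorm _ _ Y _ _ FF _ _ _ cv0 ltr01.
move=> /nbhs_rnormP[d d0 dv]; exists (2 / d); first by rewrite divr_gt0.
move=> u Gu; have [u0|u0] := eqVneq (rnorm u) 0.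
  have -> : v u = 0 by rewrite -v0; congr v; exact: rnorm_eq0.
  by rewrite rnorm_zero u0 mulr0.
have u_gt0 : 0 < rnorm u by rewrite lt_neqAle eq_sym u0 rnorm_ge0.
pose c := d / 2 / rnorm u.
have c0 : 0 < c by rewrite !divr_gt0.
have cr : rnorm (of_real k c) = c by rewrite rnorm_of_real// ltW.
have : rnorm (0 - of_real k c *: u) < d.
  rewrite sub0r rnormN_zmod rnormZ cr /c divfK//.
  by rewrite ltr_pdivrMr// ltr_pMr// ltr1n.
move=> /dv /(_ (GZ _ _ Gu)); rewrite vZ// sub0r rnormN_zmod rnormZ cr /c => h.
have : rnorm (v u) < rnorm u / (d / 2).
  have d20 : 0 < d / 2 by rewrite divr_gt0.
  by move: h; rewrite mulrAC ltr_pdivrMr// mul1r mulrC ltr_pdivlMr.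
by rewrite [2 / d * _]mulrC [2 / d]mulrC -[X in d^-1 * X]invrK -invfM => /ltW.
Qed.

Context {p : R} {p1 : 1 <= p} {m : nat} {X Y : normedModType K}.
Hypothesis m_gt0 : (0 < m)%N.
Local Notation B := (weak_star_ball m X).

(** A polynomial that factors is summing: the bound on [v] reduces the inequality
    to tensors in [L_p], whose norms are integrals over the ball, bounded by the
    supremum because [mu] is a probability. *)
Lemma factorization_summing (P : X -> Y) (mu : probability (borel B) R)
    (G : set (Lp k mu p1)) (v : Lp k mu p1 -> Y) :
  submod_closed (mem G) ->
  (forall a : K, {in G &, forall x y, v (a *: x + y) = a *: v x + v y}) ->
  {within G, continuous v} ->
  (forall x, G (j_p mu p1 (delta m x))) ->
  (forall x, v (j_p mu p1 (delta m x)) = P x) ->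
  factorable_strongly_summing p m P.
Proof.
move=> sG vlin cv GJ vJ.
have [C C0 vC] := bounded_on_subspace sG vlin cv.
have Gs s : G (Lp_tensor mu s) /\ v (Lp_tensor mu s) = tensor_map P s.
  have [Gs ->] := linear_tensor_map sG vlin GJ s; split=> //.
  by congr tensor_map; exact/funext.
exists C; first exact: ltW.
move=> n1 n2 x l _ _; have p0 : 0 < p by exact: lt_le_trans p1.
set S := ereal_sup _.
pose ts j : tensor_rep X := [seq (l j i, x j i) | i <- enum 'I_n2].
have PE j : \sum_(i < n2) l j i *: P (x j i) = tensor_map P (ts j).
  by rewrite /tensor_map big_map big_enum.
have tE j q : \sum_(i < n2) l j i * q (x j i) = tensor_eval (ts j) q.
  by rewrite /tensor_eval big_map big_enum.
under eq_bigr do rewrite PE.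
have Sub q : poly_ball m X q ->
    (((\sum_(j < n1) rnorm (tensor_eval (ts j) q) `^ p) `^ p^-1)%:E <= S)%E.
  move=> bq; apply: ereal_sup_ubound; exists q; first exact: bq.
  congr ((_ `^ _)%:E); apply: eq_bigr => j _.
  by rewrite tE.
have S0 : (0 <= S)%E.
  apply: le_trans (Sub _ (poly_ball0 m X)).
  by rewrite lee_fin powR_ge0.
case: S S0 Sub => [S|_ _|//]; last by rewrite mulry gtr0_sg// mul1e leey.
rewrite lee_fin => S0 Sub; rewrite -EFinM lee_fin.
have CS0 : 0 <= C * S by rewrite mulr_ge0// ltW.
rewrite -(powRKV p1 CS0); apply: le_powRV => //.
  by apply: sumr_ge0 => j _; exact: powR_ge0.
apply: (@le_trans _ _
  (\sum_(j < n1) C `^ p * rnorm (Lp_tensor mu (p1 := p1) (ts j)) `^ p)).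
  apply: ler_sum => j _; have [Gj <-] := Gs (ts j).
  rewrite -powRM ?rnorm_ge0 ?(ltW C0)//; apply: le_powR; [by []|exact: rnorm_ge0|].
  exact: vC.
rewrite -mulr_sumr powRM// ?(ltW C0)// ler_wpM2l ?powR_ge0//.
rewrite -lee_fin -sumEFin.
under eq_bigr do rewrite Lp_tensor_norm//.
have mt j : measurable_fun [set: borel B]
    (fun q : borel B => (rnorm (ball_eval (ts j) q) `^ p)%:E).
  apply/measurable_EFinP; apply: continuous_borel_measurable.
  exact: ball_eval_rnorm_continuous.
rewrite -ge0_integral_sum//; last by move=> j q _; rewrite lee_fin powR_ge0.
apply: (@le_trans _ _ (\int[mu]_q (S `^ p)%:E)%E).
  apply: ge0_le_integral => //.
  - by move=> q _; apply: sume_ge0 => j _; rewrite lee_fin powR_ge0.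
  - exact: emeasurable_sum.
  move=> q _; rewrite sumEFin lee_fin.
  have bq : poly_ball m X (val (q : unit_ball m X)).
    by have := valP (q : unit_ball m X); rewrite inE.
  have := Sub _ bq; rewrite lee_fin => h.
  rewrite -[leLHS](powRVK p1); last first.
    by apply: sumr_ge0 => j _; exact: powR_ge0.
  by apply: le_powR => //; exact: powR_ge0.
rewrite integral_cst// [X in (_ * X)%E](_ : _ = 1%E) ?mule1//.
exact: probability_setT.
Qed.

End factorization.

(** * Pietsch domination *)

(** Summing over a sequence padded with a default value at which [f] vanishes. *)
Lemma sum_nth_pad (V : zmodType) (A : Type) (a0 : A) (f : A -> V) (s : seq A) n :
  f a0 = 0 -> (size s <= n)%N -> \sum_(i < n) f (nth a0 s i) = \sum_(a <- s) f a.
Proof.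
move=> f0 sn; rewrite [RHS](big_nth a0) big_mkord.
rewrite [RHS](big_ord_widen n (fun i => f (nth a0 s i)))// [RHS]big_mkcond.
apply: eq_bigr => i _.
by case: ltnP => // si; rewrite nth_default.
Qed.

Section domination.
Context {R : realType} {k : scalar_kind}.
Local Notation K := (scalar_field R k).
Context {p : R} {p1 : 1 <= p} {m : nat} {X Y : normedModType K}.
Hypothesis m_gt0 : (0 < m)%N.
Local Notation B := (weak_star_ball m X).
Variable P : X -> Y.

Section gap.
Variable C : R.
Hypothesis C_gt0 : 0 < C.

(** The gap in the desired domination inequality, summed over a finite family
    of tensors. *)
Definition gap (l : seq (tensor_rep X)) (q : B) : R :=
  \sum_(s <- l) (C `^ p * rnorm (ball_eval s q) `^ p - rnorm (tensor_map P s) `^ p).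

Lemma gap_cat l1 l2 : gap (l1 ++ l2) = gap l1 + gap l2.
Proof. by apply/funext => q; rewrite /gap big_cat. Qed.

Lemma gap_nil : gap [::] = cst 0.
Proof. by apply/funext => q; rewrite /gap big_nil. Qed.

Lemma gap_continuous l : continuous (gap l).
Proof.
elim: l => [|s l IHl]; first by rewrite gap_nil; exact: cst_continuous.
rewrite -cat1s gap_cat => q; apply: (@continuousD _ R^o B); last exact: IHl.
rewrite (_ : gap [:: s] = fun q : B =>
  C `^ p * rnorm (ball_eval s q) `^ p - rnorm (tensor_map P s) `^ p); last first.
  by apply/funext => r; rewrite /gap big_seq1.
apply: (@continuousB _ R^o B); last exact: cst_continuous.
apply: (@continuousM R B); first exact: cst_continuous.
exact: ball_eval_rnorm_continuous.
Qed.

(** The gaps are stable under multiplication by nonnegative numbers. *)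
Lemma gap_scale (a : R) l : 0 <= a -> exists l', gap l' = a *: gap l.
Proof.
move=> a0; pose c := of_real k (a `^ p^-1).
have cp : rnorm c `^ p = a by rewrite rnorm_of_real ?powR_ge0// powRVK.
pose sc (s : tensor_rep X) : tensor_rep X := [seq (c * b.1, b.2) | b <- s].
exists (map sc l); apply/funext => q; rewrite /gap big_map.
rewrite -[RHS]/(a * _) mulr_sumr; apply: eq_bigr => s _.
have -> : ball_eval (sc s) q = c * ball_eval s q.
  rewrite /ball_eval /tensor_eval big_map mulr_sumr.
  by apply: eq_bigr => b _; rewrite mulrA.
have -> : tensor_map P (sc s) = c *: tensor_map P s.
  rewrite /tensor_map big_map scaler_sumr.
  by apply: eq_bigr => b _; rewrite scalerA.
rewrite rnormM rnormZ !powRM ?rnorm_ge0// cp mulrBr.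
by rewrite mulrCA.
Qed.

Hypothesis hP : forall (m1 m2 : nat) (x : 'I_m1 -> 'I_m2 -> X)
    (l : 'I_m1 -> 'I_m2 -> K), (0 < m1)%N -> (0 < m2)%N ->
  (((\sum_(j < m1) rnorm (\sum_(i < m2) l j i *: P (x j i)) `^ p) `^ p^-1)%:E
   <= C%:E * ereal_sup
        [set ((\sum_(j < m1) rnorm (\sum_(i < m2) l j i * q (x j i)) `^ p)
                `^ p^-1)%:E | q in poly_ball m X])%E.

(** The summing inequality says that no gap is everywhere negative. *)
Lemma gap_sup_ge0 l (r : R) : (forall q, gap l q <= r) -> 0 <= r.
Proof.
move=> lr; rewrite leNgt; apply/negP => r0.
have p0 : 0 < p by exact: lt_le_trans p1.
have [l0|l_gt0] := posnP (size l).
  by have := lr point; rewrite (size0nil l0) gap_nil leNgt r0.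
(* All the tensors of the family are padded to the same length [n2 > 0]. *)
pose n1 := size l; pose n2 := (\max_(s <- l) size s).+1.
pose t (j : 'I_n1) := nth [::] l j.
have tn2 j : (size (t j) <= n2)%N.
  rewrite /n2 leqW//; apply: (@leq_bigmax_seq _ _ xpredT) => //.
  exact: mem_nth.
pose x (j : 'I_n1) (i : 'I_n2) := (nth (0, 0) (t j) i).2.
pose c (j : 'I_n1) (i : 'I_n2) := (nth (0, 0) (t j) i).1.
have PE j : \sum_(i < n2) c j i *: P (x j i) = tensor_map P (t j).
  by apply: (sum_nth_pad (f := fun a => a.1 *: P a.2)); rewrite ?scale0r.
have tE j (q : X -> K^o) : \sum_(i < n2) c j i * q (x j i) = tensor_eval (t j) q.
  by apply: (sum_nth_pad (f := fun a => a.1 * q a.2)); rewrite ?mul0r.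
have := hP x c l_gt0 (ltn0Sn _); under eq_bigr do rewrite PE.
set A := \sum_(j < n1) _; set S := ereal_sup _ => AS.
have A0 : 0 <= A by apply: sumr_ge0 => j _; exact: powR_ge0.
have Cp : 0 < C `^ p by rewrite powR_gt0.
have le_r (q : B) :
    C `^ p * \sum_(j < n1) rnorm (ball_eval (t j) q) `^ p <= A + r.
  have := lr q; rewrite /gap (big_nth [::]) big_mkord big_split /= sumrN -mulr_sumr.
  by rewrite lerBlDl.
have Ar : 0 <= A + r.
  apply: le_trans (le_r point); rewrite mulr_ge0 ?powR_ge0// sumr_ge0// => j _.
  exact: powR_ge0.
have SA : (S <= (((A + r) / C `^ p) `^ p^-1)%:E)%E.
  apply: ge_ereal_sup => _ [q bq <-]; rewrite lee_fin; apply: le_powRV => //.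
    by apply: sumr_ge0 => j _; exact: powR_ge0.
  rewrite ler_pdivlMr// mulrC.
  have := le_r (SigSub (mem_set bq)); congr (_ * _ <= _).
  by apply: eq_bigr => j _; rewrite tE.
have := le_trans AS (lee_wpmul2l (ltW C_gt0 : (0 <= C%:E)%E) SA).
rewrite -EFinM lee_fin => /(le_powR p1 (powR_ge0 _ _)).
have ArC : 0 <= (A + r) / C `^ p by rewrite divr_ge0// powR_ge0.
rewrite (powRM _ (ltW C_gt0) (powR_ge0 _ _)) (powRVK p1 A0) (powRVK p1 ArC).
by rewrite mulrC divfK ?gt_eqF// => h; lra.
Qed.

Let msup (g : B -> R) : R := sup (range g).

Let msup_ub (g : B -> R) q : continuous g -> g q <= msup g.
Proof.
move=> cg; have /compact_bounded[M [_ /(_ (M + 1))]] : compact (g @` setT).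
  apply: continuous_compact; first exact: continuous_subspaceT.
  exact: weak_star_ball_compact.
rewrite ltrDl ltr01 => /(_ isT) bM.
apply: ub_le_sup; last by exists q.
by exists (M + 1) => _ [x _ <-]; apply: le_trans (ler_norm _) _; apply: bM; exists x.
Qed.

Let msup_le (g : B -> R) (r : R) : (forall q, g q <= r) -> msup g <= r.
Proof.
by move=> gr; apply: ge_sup; [exists (g point), point|move=> _ [q _ <-]].
Qed.

(* A linear functional below [phi] is positive, has value [1] at the constant [1]
   and is nonnegative at every gap. *)
Let phi (g : B -> R) : R := inf [set msup (g + gap l) | l in setT].

Let cgap (g : B -> R) l : continuous g -> continuous (g + gap l).
Proof.
by move=> cg q; apply: (@continuousD _ R^o B); [exact: cg|exact: gap_continuous].
Qed.

Let cN (g : B -> R) : continuous g -> continuous (- g).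
Proof. by move=> cg q; apply: (@continuousN _ R^o B); exact: cg. Qed.

Let phi_lb (g : B -> R) l : continuous g -> - msup (- g) <= msup (g + gap l).
Proof.
move=> cg; rewrite -subr_ge0 opprK; apply: (@gap_sup_ge0 l) => q.
have h1 := msup_ub q (cgap (l := l) cg); have h2 := msup_ub q (cN cg).
apply: le_trans (lerD h1 h2).
by rewrite -[(_ + _) q]/(g q + gap l q) -[(- _) q]/(- g q); lra.
Qed.

Let phi_le (g : B -> R) l : continuous g -> phi g <= msup (g + gap l).
Proof.
move=> cg; apply: ge_inf; last by exists l.
by exists (- msup (- g)) => _ [l' _ <-]; exact: phi_lb.
Qed.

Let phi_ge (g : B -> R) r : (forall l, r <= msup (g + gap l)) -> r <= phi g.
Proof.
move=> gr; apply: lb_le_inf; first by exists (msup (g + gap [::])), [::].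
by move=> _ [l _ <-].
Qed.

Let phi_sublinear : sublinear_on [set g : B -> R | continuous g] phi.
Proof.
split=> [f g /= cf cg|a g a0 /= cg].
  have cfg : continuous (f + g).
    by move=> q; apply: (@continuousD _ R^o B); [exact: cf|exact: cg].
  rewrite -lerBlDr; apply: phi_ge => l1; rewrite lerBlDl -lerBlDr.
  apply: phi_ge => l2; rewrite lerBlDr.
  apply: le_trans (phi_le (l1 ++ l2) cfg) _; apply: msup_le => q.
  rewrite gap_cat addrACA addrC.
  by apply: lerD; apply: msup_ub; exact: cgap.
have cag : continuous (a *: g).
  by move=> q; apply: (@continuousZr _ R^o B); exact: cg.
have main l : phi (a *: g) <= a * msup (g + gap l).
  have [l' l'E] := gap_scale l a0.
  apply: le_trans (phi_le l' cag) _; apply: msup_le => q.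
  by rewrite l'E -scalerDr ler_wpM2l//; apply: msup_ub; exact: cgap.
move: a0; rewrite le_eqVlt => /predU1P[a0|a0].
  by have := main [::]; rewrite -a0 !mul0r.
by rewrite -ler_pdivrMl//; apply: phi_ge => l; rewrite ler_pdivrMl.
Qed.

(** Pietsch domination: Hahn-Banach gives a linear functional below [phi], and the
    Riesz representation a measure. *)
Lemma pietsch_domination : exists mu : probability (borel B) R,
  regular_measure mu /\
  forall s, rnorm (tensor_map P s) <= C * rnorm (Lp_tensor (p1 := p1) mu s).
Proof.
have p0 : 0 < p by exact: lt_le_trans p1.
have c0 : continuous (cst 0 : B -> R) by exact: cst_continuous.
have clin (a : R) (f g : B -> R) :
    continuous f -> continuous g -> continuous (a *: f + g).
  move=> cf cg q; apply: (@continuousD _ R^o B); last exact: cg.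
  by apply: (@continuousZr _ R^o B); exact: cf.
have [L [Lphi Llin]] := sublinear_dominates_linear c0 clin phi_sublinear.
have Lsup (g : B -> R) : continuous g -> L g <= msup g.
  move=> cg; apply: le_trans (Lphi _ cg) _; have := phi_le [::] cg.
  by rewrite gap_nil (_ : g + cst 0 = g)//; apply/funext => q; rewrite [LHS]addr0.
have L0 : L (cst 0) = 0.
  have := Llin (-1) _ _ c0 c0; rewrite (_ : _ + _ = cst 0).
    by rewrite mulN1r addNr.
  by apply/funext => q; rewrite -[LHS]/(-1 * 0 + 0) mulr0 addr0.
have LN (g : B -> R) : continuous g -> L (- g) = - L g.
  move=> cg; have := Llin (-1) _ _ cg c0; rewrite L0 mulN1r => LH.
  rewrite -[RHS]addr0 -LH; congr L.
  by apply/funext => q; rewrite -[RHS]/(-1 * g q + 0) mulN1r addr0.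
have Lpos (g : B -> R) : continuous g -> (forall q, 0 <= g q) -> 0 <= L g.
  move=> cg g0; rewrite -oppr_le0 -LN//; apply: le_trans (Lsup _ (cN cg)) _.
  by apply: msup_le => q; rewrite -[leLHS]/(- g q) oppr_le0.
have L1 : L (cst 1) = 1.
  have c1 : continuous (cst 1 : B -> R) by exact: cst_continuous.
  apply/eqP; rewrite eq_le; apply/andP; split.
    by apply: le_trans (Lsup _ c1) _; exact: msup_le.
  rewrite -lerN2 -LN//; apply: le_trans (Lsup _ (cN c1)) _.
  exact: msup_le.
have [mu [rmu Lmu]] := riesz_regular_probability (weak_star_ball_compact m_gt0)
  weak_star_ball_hausdorff Llin Lpos L1.
exists mu; split=> // s.
have cs : continuous (fun q : B => rnorm (ball_eval s q) `^ p).
  exact: ball_eval_rnorm_continuous.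
pose N := rnorm (tensor_map P s) `^ p.
have Ls : N <= C `^ p * L (fun q : B => rnorm (ball_eval s q) `^ p).
  have cg : continuous (gap [:: s]) by exact: gap_continuous.
  (* By definition, [phi (- gap [:: s])] is at most the supremum of
     [- gap [:: s] + gap [:: s]]. *)
  have : L (- gap [:: s]) <= 0.
    apply: le_trans (Lphi _ (cN cg)) _.
    apply: le_trans (phi_le [:: s] (cN cg)) _.
    by apply: msup_le => q; rewrite addNr.
  have -> : - gap [:: s] =
      - C `^ p *: (fun q : B => rnorm (ball_eval s q) `^ p) + N *: cst 1.
    apply/funext => q; rewrite -[LHS]/(- gap [:: s] q) /gap big_seq1 opprB addrC.
    by rewrite -[RHS]/(- C `^ p * rnorm (ball_eval s q) `^ p + N * 1) mulr1 mulNr.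
  rewrite Llin//; last by move=> q; apply: (@continuousZr _ R^o B); exact: cst_continuous.
  have -> : N *: cst 1 = N *: cst 1 + cst 0 :> (B -> R).
    by apply/funext => q; rewrite [RHS]addr0.
  rewrite Llin//; last exact: cst_continuous.
  by rewrite L1 L0 mulr1 addr0 mulNr addrC subr_le0.
apply: (le_of_powR p1 (ltW C_gt0)) => //; do ?exact: rnorm_ge0.
apply: le_trans Ls _; rewrite ler_wpM2l ?powR_ge0//.
rewrite -lee_fin (Lp_tensor_norm m_gt0).
by apply: (Lmu _ cs) => q; exact: powR_ge0.
Qed.

End gap.

End domination.

(** * The factorization theorem *)

Theorem theorem4p5 (R : realType) (k : scalar_kind) (p : R) (p1 : 1 <= p)
    (m : nat) (m1 : (1 <= m)%N) (X Y : completeNormedModType (scalar_field R k))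
    (P : X -> Y) (hP : cont_hom_poly m P) :
  factorable_strongly_summing p m P <->
  exists (mu : probability (borel (weak_star_ball m X)) R)
         (G : set (Lp k mu p1)) (v0 : Lp k mu p1 -> Y),
    [/\ regular_measure mu,
        closed G /\ submod_closed (mem G),
        (forall a : scalar_field R k,
           {in G &, forall u v, v0 (a *: u + v) = a *: v0 u + v0 v}) /\
        {within G, continuous v0},
        range (j_p mu p1 \o delta m) `<=` G &
        v0 \o (j_p mu p1 \o delta m) = P].
Proof.
split; last first.
  move=> [mu [G [v [_ [_ sG] [vlin cv] GJ vJ]]]].
  apply: (factorization_summing m1 sG vlin cv) => x.
    by apply: GJ; exists x.
  by rewrite -vJ.
move=> [C C0 CP].
(* The constant is enlarged so as to be positive. *)
have C1 : 0 < C + 1 by rewrite ltr_wpDl.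
have [|mu [rmu muP]] := @pietsch_domination R k p p1 m X Y m1 P (C + 1) C1.
  move=> n1 n2 x l n1_gt0 n2_gt0; apply: le_trans (CP _ _ x l n1_gt0 n2_gt0) _.
  apply: lee_wpmul2r; last by rewrite lee_fin lerDl.
  apply: le_ereal_sup_tmp; eexists; first by exists (fun=> 0); [exact: poly_ball0|].
  by rewrite lee_fin powR_ge0.
pose J := Lp_tensor (p1 := p1) mu; pose T := tensor_map P.
have J0 : J [::] = 0 by exact: tensor_map_nil.
have comb a s t : exists r, J r = a *: J s + J t /\ T r = a *: T s + T t.
  exists ([seq (a * b.1, b.2) | b <- s] ++ t).
  by split; exact: tensor_map_comb.
have [v [cG sG vlin cv vJ]] := extend_by_density (ltW C1) J0 comb muP.
have Jx x : J [:: (1, x)] = j_p mu p1 (delta m x).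
  exact: tensor_map1.
exists mu, (closure (range J)), v; split=> //.
  move=> _ [x _ <-]; apply: subset_closure; exists [:: (1, x)] => //.
  exact: Jx.
apply/funext => x; rewrite /= -Jx vJ.
exact: tensor_map1.
Qed.
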